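(* Let $I\subset\mathbb R$ be an interval, $m>0$, and let $(\gamma,f):I\to\mathbb C\times\mathbb R$ be a $C^2$ curve with $|\gamma|^2+f^2=1$. Let $T$ be the twizzler in $\mathbb S^3\subset\mathbb C\times\mathbb C\cong\mathbb R^4$ parameterized by $$T(u,v)=(e^{iv}\gamma(u),\,e^{imv}f(u)),\qquad (u,v)\in I\times\mathbb R,$$ and suppose $T$ is an immersion. Then $T$ has constant mean curvature in $\mathbb S^3$ if and only if there are real constants $H$ and $C$ such that, at every $u\in I$, $$C=\frac{2\pi}{\sqrt g}\,m f^2\,(\gamma'\cdot i\gamma)-H\pi|\gamma|^2,$$ where $g=(T_u\cdot T_u)(T_v\cdot T_v)-(T_u\cdot T_v)^2$. Further, if $T$ is not a torus, then $H$ is the mean curvature of $T$.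
   Context: $\mathbb S^3=\{x\in\mathbb R^4: x\cdot x=1\}$ with the metric induced by the Euclidean inner product $\cdot$; $\mathbb R^4$ is identified with $\mathbb C\times\mathbb C$ via $(x_1,x_2,x_3,x_4)\leftrightarrow(x_1+ix_2,x_3+ix_4)$; $\gamma'\cdot i\gamma$ is the real inner product in $\mathbb C\cong\mathbb R^2$. The quantity $g$ depends only on $u$. Mean curvature is the trace (not the average) of the second fundamental form of $T$ in $\mathbb S^3$, with sign given by $h=\mathrm{div}(\boldsymbol\nu)=\mathrm D_{\mathbf f_1}\boldsymbol\nu\cdot\mathbf f_1+\mathrm D_{\mathbf f_2}\boldsymbol\nu\cdot\mathbf f_2$, where $\mathrm D$ is the Levi-Civita connection of $\mathbb S^3$, $(\mathbf f_1,\mathbf f_2)$ is a local orthonormal tangent frame of $T$, and $\boldsymbol\nu$ is the unit normal of $T$ in $\mathbb S^3$ with $\det(T,T_u,T_v,\boldsymbol\nu)>0$. A torus in $\mathbb S^3$ is a surface $(u,v)\mapsto(\cos\xi\, e^{iu},\sin\xi\, e^{iv})$ with $\xi$ constant; ''$T$ is a torus'' means that $T$ lies on such a torus, i.e. $|\gamma|$ is constant on $I$. *)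

(* Defs.v *)
From Stdlib Require Import Reals ClassicalEpsilon.
From Coquelicot Require Import Coquelicot.
Open Scope R_scope.

(* Open, closed, half-open and unbounded intervals; a single point is excluded,
   since derivatives make no sense there. *)
Definition is_interval (I : R -> Prop) : Prop :=
  (forall x y z, I x -> I y -> x <= z <= y -> I z) /\
  (exists x y, I x /\ I y /\ x < y).

Definition whole_line : R -> Prop := fun _ => True.

(* Coquelicot's [is_derive] with [locally x] restricted to [I]: it is one-sided
   at an end point of [I] that belongs to [I], and ignores values outside [I]. *)
Definition is_derive_in {V : NormedModule R_AbsRing}
    (I : R -> Prop) (f : R -> V) (x : R) (l : V) : Prop :=
  filterdiff (U := R_NormedModule) f (within I (locally x)) (fun y => scal y l).

Definition ex_derive_in {V : NormedModule R_AbsRing}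
    (I : R -> Prop) (f : R -> V) (x : R) : Prop :=
  exists l : V, is_derive_in I f x l.

(* Unspecified where [f] has no derivative. *)
Definition Derive_in {V : NormedModule R_AbsRing}
    (I : R -> Prop) (f : R -> V) (x : R) : V :=
  epsilon (inhabits zero) (is_derive_in I f x).

Definition C2_on {V : NormedModule R_AbsRing} (I : R -> Prop) (f : R -> V) : Prop :=
  (forall x, I x -> ex_derive_in I f x) /\
  (forall x, I x -> ex_derive_in I (Derive_in I f) x) /\
  continuous_on I (Derive_in I (Derive_in I f)).

Definition CxR : NormedModule R_AbsRing :=
  prod_NormedModule R_AbsRing C_R_NormedModule R_NormedModule.

(* R^4 as C x C, a normed space over the reals:
   (x1, x2, x3, x4) is ((x1, x2), (x3, x4)). *)
Definition R4 : NormedModule R_AbsRing :=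
  prod_NormedModule R_AbsRing C_R_NormedModule C_R_NormedModule.

Definition dotC (z w : C) : R := fst z * fst w + snd z * snd w.

Definition dot (p q : R4) : R := dotC (fst p) (fst q) + dotC (snd p) (snd q).

Definition det2 (a b c d : R) : R := a * d - b * c.

(* Laplace expansion along the first two of the four rows [p], [q], [r], [s]. *)
Definition det4 (p q r s : R4) : R :=
  let: ((p1, p2), (p3, p4)) := p in
  let: ((q1, q2), (q3, q4)) := q in
  let: ((r1, r2), (r3, r4)) := r in
  let: ((s1, s2), (s3, s4)) := s in
    det2 p1 p2 q1 q2 * det2 r3 r4 s3 s4
  - det2 p1 p3 q1 q3 * det2 r2 r4 s2 s4
  + det2 p1 p4 q1 q4 * det2 r2 r3 s2 s3
  + det2 p2 p3 q2 q3 * det2 r1 r4 s1 s4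
  - det2 p2 p4 q2 q4 * det2 r1 r3 s1 s3
  + det2 p3 p4 q3 q4 * det2 r1 r2 s1 s2.

Definition expi (t : R) : C := (cos t, sin t).

Definition twizzler (m : R) (gamma : R -> C) (f : R -> R) (u v : R) : R4 :=
  ((expi v * gamma u)%C, (expi (m * v) * RtoC (f u))%C).

(* Surfaces [T] in S^3 with parameter domain I x R. *)

Definition d_u (I : R -> Prop) (X : R -> R -> R4) (u v : R) : R4 :=
  Derive_in I (fun x => X x v) u.

Definition d_v (X : R -> R -> R4) (u v : R) : R4 :=
  Derive_in whole_line (fun y => X u y) v.

Definition comb (a b : R) (X Y : R4) : R4 := plus (scal a X) (scal b Y).

(* Injectivity of the differential; it is used only for [T] of class C^2. *)
Definition immersion_on (I : R -> Prop) (T : R -> R -> R4) : Prop :=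
  forall u v, I u -> forall a b,
    comb a b (d_u I T u v) (d_v T u v) = zero -> a = 0 /\ b = 0.

Definition metric_det (I : R -> Prop) (T : R -> R -> R4) (u v : R) : R :=
  dot (d_u I T u v) (d_u I T u v) * dot (d_v T u v) (d_v T u v)
  - (dot (d_u I T u v) (d_v T u v)) ^ 2.

Definition is_unit_normal (I : R -> Prop) (T nu : R -> R -> R4) : Prop :=
  forall u v, I u ->
    dot (nu u v) (T u v) = 0 /\
    dot (nu u v) (d_u I T u v) = 0 /\
    dot (nu u v) (d_v T u v) = 0 /\
    dot (nu u v) (nu u v) = 1 /\
    0 < det4 (T u v) (d_u I T u v) (d_v T u v) (nu u v).

(* Levi-Civita derivative in S^3, along the tangent vector a T_u + b T_v, of a
   field [X] along [T]: the derivative in R^4 projected to the tangent space of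
   S^3 at the point T(u,v). *)
Definition cov_deriv (I : R -> Prop) (T X : R -> R -> R4) (u v a b : R) : R4 :=
  let w := comb a b (d_u I X u v) (d_v X u v) in
  minus w (scal (dot w (T u v)) (T u v)).

(* f1 = a1 T_u + b1 T_v and f2 = a2 T_u + b2 T_v run over all orthonormal bases
   of the tangent plane; one exists because det4 > 0 forces T_u and T_v to be
   independent. *)
Definition is_mean_curvature (I : R -> Prop) (T : R -> R -> R4) (u v h : R) : Prop :=
  exists nu : R -> R -> R4,
    is_unit_normal I T nu /\
    ex_derive_in I (fun x => nu x v) u /\
    ex_derive_in whole_line (fun y => nu u y) v /\
    forall a1 b1 a2 b2,
      let f1 := comb a1 b1 (d_u I T u v) (d_v T u v) in
      let f2 := comb a2 b2 (d_u I T u v) (d_v T u v) in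
      dot f1 f1 = 1 -> dot f2 f2 = 1 -> dot f1 f2 = 0 ->
      h = dot (cov_deriv I T nu u v a1 b1) f1 + dot (cov_deriv I T nu u v a2 b2) f2.

Definition has_mean_curvature (I : R -> Prop) (T : R -> R -> R4) (H : R) : Prop :=
  forall u v, I u -> is_mean_curvature I T u v H.

Definition constant_mean_curvature (I : R -> Prop) (T : R -> R -> R4) : Prop :=
  exists H : R, has_mean_curvature I T H.

Definition lies_on_torus (I : R -> Prop) (T : R -> R -> R4) : Prop :=
  exists xi : R, forall u v, I u -> exists s t : R,
    T u v = ((RtoC (cos xi) * expi s)%C, (RtoC (sin xi) * expi t)%C).

(* The determinant of the metric of a twizzler does not depend on v, so the
   quantifier over v is harmless. *)
Definition first_integral (I : R -> Prop) (m : R) (gamma : R -> C) (f : R -> R)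
    (H c : R) : Prop :=
  forall u v, I u ->
    c = 2 * PI / sqrt (metric_det I (twizzler m gamma f) u v)
          * m * f u ^ 2
          * dotC (Derive_in (V := C_R_NormedModule) I gamma u) (Ci * gamma u)%C
        - H * PI * Cmod (gamma u) ^ 2.

(* Main.v *)
(* Let h(u) be the mean curvature, s = |gamma|^2 and W = m f^2 (gamma'.i gamma) / sqrt g.
   Up to the factor m, W is the flux of the Killing field (z, w) |-> (i z, 0) of S^3
   across the curves u = const, which gives W' = h s' / 2. So 2 W - H s is constant if
   h = H; conversely, if it is constant, then (h - H) s' = 0. Where s' vanishes on an
   interval, T is locally a piece of a torus and h W = 1 - 2 s with s and W constant, so h
   is locally constant; by continuity h can then differ from H at one point only if
   s' = 0 on the whole of I. *)

Require Import Defs.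
From Stdlib Require Import Reals Lra Nsatz ClassicalEpsilon.
From Coquelicot Require Import Coquelicot.
Open Scope R_scope.

(** * Derivatives within an interval *)

(** With K = (i z, 0), the tangential part of K along T has divergence - h (nu.K), so the flux m W
    changes at the rate - h (nu.K) sqrt g = - h det(T, T_u, T_v, K). On the sphere this determinant
    equals - m gamma.gamma', which is where s' / 2 = gamma.gamma' comes from. The formal argument
    avoids divergences: h is brought into the classical form - nu.(G T_uu - 2 F T_uv + E T_vv) / g,
    the rotations move everything to v = 0, and the law for W becomes a polynomial identity modulo
    |gamma|^2 + f^2 = 1 and its derivative. Two obstacles shape the rest. For a C^2 curve h is
    merely continuous, so it cannot be differentiated; its local constancy has to be read off from h
    W = 1 - 2 s, where W must be known not to vanish. And derivatives are taken within I, one-sided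
    at its end points, so uniqueness of derivatives and the constancy of functions with zero
    derivative are needed in that form. *)

Definition has_deriv (I : R -> Prop) (f : R -> R) (x l : R) : Prop :=
  is_derive_in (V := R_NormedModule) I f x l.

Definition continuous_in (I : R -> Prop) (f : R -> R) (x : R) : Prop :=
  filterlim f (within I (locally x)) (locally (f x)).

Lemma within_locally_proper (I : R -> Prop) (x : R) :
  I x -> ProperFilter (within I (locally x)).
Proof.
intros Hx; constructor.
- intros P [d Hd]; exists x; apply Hd; [apply ball_center | exact Hx].
- apply within_filter, locally_filter.
Qed.

Lemma within_locally_lim (I : R -> Prop) (x : R) :
  is_filter_lim (T := R_UniformSpace) (within I (locally x)) x.
Proof. intros P HP; apply filter_le_within; auto; apply locally_filter. Qed.

(** [filterdiff] speaks of every limit point of its filter; for [x] in [I] the filter is proper, so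
    [x] is the only one. *)
Lemma within_locally_lim_unique (I : R -> Prop) (x y : R) :
  I x -> is_filter_lim (T := R_UniformSpace) (within I (locally x)) y -> y = x.
Proof.
intros Hx Hy.
pose proof (within_locally_proper I x Hx) as HP.
apply (is_filter_lim_unique (K := R_AbsRing) (V := R_NormedModule) (F := within I (locally x)));
  [exact Hy | apply within_locally_lim].
Qed.

Section NormedModuleValued.
Context {V W : NormedModule R_AbsRing} (I : R -> Prop) (x : R).

Lemma is_derive_in_ext_loc (f g : R -> V) (l : V) :
  I x -> within I (locally x) (fun y => f y = g y) ->
  is_derive_in I f x l -> is_derive_in I g x l.
Proof.
intros Hx Hfg; pose proof (within_locally_proper I x Hx) as HP.
apply filterdiff_ext_loc; [exact Hfg|].
intros y Hy; rewrite (within_locally_lim_unique I x y Hx Hy).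
exact (locally_singleton _ _ Hfg Hx).
Qed.

Lemma is_derive_in_ext (f g : R -> V) (l : V) :
  I x -> (forall y, I y -> f y = g y) ->
  is_derive_in I f x l -> is_derive_in I g x l.
Proof.
intros Hx Hfg; apply is_derive_in_ext_loc; [exact Hx|].
unfold within; apply filter_forall; exact Hfg.
Qed.

Lemma is_derive_in_continuous (f : R -> V) (l : V) :
  I x -> is_derive_in I f x l ->
  filterlim f (within I (locally x)) (locally (f x)).
Proof.
intros Hx Hf; pose proof (within_locally_proper I x Hx) as HP.
apply (filterdiff_continuous_aux (U := R_NormedModule) f);
  [now exists (fun y => scal y l) | apply within_locally_lim].
Qed.

Lemma is_derive_in_linear (f : R -> V) (l : V) (phi : V -> W) :
  is_linear phi -> is_derive_in I f x l ->
  is_derive_in I (fun y => phi (f y)) x (phi l).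
Proof.
intros Hphi Hf; unfold is_derive_in.
eapply filterdiff_ext_lin.
- apply (filterdiff_comp (U := R_NormedModule) f phi _ phi Hf).
  now apply filterdiff_linear.
- intros y; apply (linear_scal _ Hphi).
Qed.

Lemma is_derive_in_pair (f : R -> V) (g : R -> W) (l : V) (k : W) :
  is_derive_in I f x l -> is_derive_in I g x k ->
  is_derive_in (V := prod_NormedModule R_AbsRing V W) I (fun y => (f y, g y)) x (l, k).
Proof.
intros Hf Hg; unfold is_derive_in.
apply (filterdiff_comp_2 (T := R_NormedModule)
         (W := prod_NormedModule R_AbsRing V W) f g (fun a b => (a, b))
         (fun y => scal y l) (fun y => scal y k) (fun a b => (a, b)) Hf Hg).
apply filterdiff_linear, is_linear_prod; [apply is_linear_fst | apply is_linear_snd].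
Qed.

Lemma is_derive_in_const (a : V) : is_derive_in I (fun _ => a) x zero.
Proof.
unfold is_derive_in; eapply filterdiff_ext_lin.
- apply filterdiff_const.
- intros y; exact (eq_sym (scal_zero_r (V := NormedModule.ModuleSpace R_AbsRing V) y)).
Qed.

End NormedModuleValued.

Section RealValued.
Variables (I : R -> Prop) (x : R).

Lemma has_deriv_comp (f g : R -> R) (l k : R) :
  I x -> has_deriv I f x l -> is_derive g (f x) k ->
  has_deriv I (fun y => g (f y)) x (l * k).
Proof.
intros Hx Hf Hg; pose proof (within_locally_proper I x Hx) as HP.
unfold has_deriv, is_derive_in.
eapply filterdiff_ext_lin.
- apply (filterdiff_comp (U := R_NormedModule) (V := R_NormedModule) f g _ (fun y => scal y k) Hf).
  apply (filterdiff_locally (U := R_NormedModule) (V := R_NormedModule)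
    (F := filtermap f (within I (locally x))) g (f x)); [|exact Hg].
  now apply (is_derive_in_continuous I x f l).
- intros y; unfold scal; simpl; unfold mult; simpl; ring.
Qed.

Lemma has_deriv_plus (f g : R -> R) (l k : R) :
  has_deriv I f x l -> has_deriv I g x k ->
  has_deriv I (fun y => f y + g y) x (l + k).
Proof.
intros Hf Hg; unfold has_deriv, is_derive_in.
eapply filterdiff_ext_lin.
- exact (filterdiff_plus_fct (U := R_NormedModule) (V := R_NormedModule) f g _ _ Hf Hg).
- intros y; unfold scal, plus; simpl; unfold mult; simpl; ring.
Qed.

Lemma filterlim_prod_locally (f g : R -> R) :
  continuous_in I f x -> continuous_in I g x ->
  filterlim (fun y => (f y, g y)) (within I (locally x)) (locally (f x, g x)).
Proof.
intros Hf Hg P [e He].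
assert (Hf' := Hf (ball (f x) e) (locally_ball _ _)).
assert (Hg' := Hg (ball (g x) e) (locally_ball _ _)).
generalize (filter_and (F := within I (locally x)) _ _ Hf' Hg'); unfold filtermap.
apply (filter_imp (F := within I (locally x))).
intros y H; apply He; exact H.
Qed.

Lemma has_deriv_continuous (f : R -> R) (l : R) :
  I x -> has_deriv I f x l -> continuous_in I f x.
Proof. intros Hx Hf; exact (is_derive_in_continuous (V:=R_NormedModule) I x f l Hx Hf). Qed.

Lemma has_deriv_mult (f g : R -> R) (l k : R) :
  I x -> has_deriv I f x l -> has_deriv I g x k ->
  has_deriv I (fun y => f y * g y) x (l * g x + f x * k).
Proof.
intros Hx Hf Hg; pose proof (within_locally_proper I x Hx) as HP.
unfold has_deriv, is_derive_in.
eapply filterdiff_ext_lin.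
- apply (filterdiff_comp_2 (T := R_NormedModule) (U := R_NormedModule)
    (V := R_NormedModule) (W := R_NormedModule) f g Rmult _ _
    (fun a b => a * g x + f x * b) Hf Hg).
  apply (filterdiff_mult (K := R_AbsRing) (f x, g x)); [|apply Rmult_comm].
  apply filterlim_prod_locally; eapply has_deriv_continuous; eauto.
- intros y; unfold scal; simpl; unfold mult; simpl; ring.
Qed.

Lemma has_deriv_const (a : R) : has_deriv I (fun _ => a) x 0.
Proof. apply (is_derive_in_const (V := R_NormedModule)). Qed.

(** Otherwise the zero function would have the nonzero slope [l - k], which any point of [I] close
    to [x] and different from it refutes. Such a point exists because [I] contains some a < b: to
    the right of [x] if x < b, and otherwise to the left, since then a < x. *)
Lemma has_deriv_unique (f : R -> R) (l k : R) :
  is_interval I -> I x -> has_deriv I f x l -> has_deriv I f x k -> l = k.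
Proof.
intros [HI [a [b [Ha [Hb Hab]]]]] Hx Hl Hk.
pose proof (within_locally_proper I x Hx) as HP.
assert (H0 : has_deriv I (fun _ => 0) x (l - k)).
{ unfold has_deriv, is_derive_in.
  eapply filterdiff_ext_lin.
  - eapply filterdiff_ext; [|exact (filterdiff_minus_fct (U := R_NormedModule) (V := R_NormedModule) f f _ _ Hl Hk)].
    intros y; apply Rminus_diag_eq; reflexivity.
  - intros y; unfold scal, minus, plus, opp; simpl; unfold mult; simpl; ring. }
destruct (Req_dec l k) as [E|E]; [exact E|exfalso].
destruct H0 as [_ H0].
assert (He : 0 < Rabs (l - k) / 2) by (apply Rdiv_lt_0_compat; [apply Rabs_pos_lt; lra | lra]).
destruct (H0 x (within_locally_lim I x) (mkposreal _ He)) as [d Hd].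
assert (Hy : exists y, I y /\ y <> x /\ Rabs (y - x) < d).
{ assert (Hd0 := cond_pos d).
  destruct (Rlt_le_dec x b) as [Hxb|Hxb].
  - exists (Rmin b (x + d / 2)).
    assert (H1 := Rmin_l b (x + d/2)); assert (H2 := Rmin_r b (x + d/2)).
    assert (H3 : x < Rmin b (x + d/2)) by (apply Rmin_glb_lt; lra).
    repeat split; [apply (HI x b); auto; lra | lra | rewrite Rabs_pos_eq; lra].
  - exists (Rmax a (x - d / 2)).
    assert (H1 := Rmax_l a (x - d/2)); assert (H2 := Rmax_r a (x - d/2)).
    assert (H3 : Rmax a (x - d/2) < x) by (apply Rmax_lub_lt; lra).
    repeat split; [apply (HI a x); auto; lra | lra | rewrite Rabs_left; lra]. }
destruct Hy as [y [Iy [Hyx Hyd]]].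
specialize (Hd y Hyd Iy).
unfold norm, minus, plus, opp, scal in Hd; simpl in Hd; unfold abs, mult in Hd; simpl in Hd.
replace (0 + - 0 + - ((y + - x) * (l - k))) with (- ((y - x) * (l - k))) in Hd by ring.
rewrite Rabs_Ropp, Rabs_mult in Hd.
fold (y - x) in Hd.
assert (0 < Rabs (y - x)) by (apply Rabs_pos_lt; lra).
nra.
Qed.

Lemma continuous_in_comp (f g : R -> R) :
  continuous_in I f x -> continuous g (f x) -> continuous_in I (fun y => g (f y)) x.
Proof. intros Hf Hg; eapply filterlim_comp; [exact Hf | exact Hg]. Qed.

Lemma continuous_in_plus (f g : R -> R) :
  continuous_in I f x -> continuous_in I g x -> continuous_in I (fun y => f y + g y) x.
Proof.
intros Hf Hg; eapply filterlim_comp_2; [exact Hf | exact Hg |].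
apply (filterlim_plus (V := R_NormedModule)).
Qed.

Lemma continuous_in_mult (f g : R -> R) :
  continuous_in I f x -> continuous_in I g x -> continuous_in I (fun y => f y * g y) x.
Proof.
intros Hf Hg; eapply filterlim_comp_2; [exact Hf | exact Hg |].
apply (filterlim_mult (K := R_AbsRing)).
Qed.

Lemma continuous_in_const (a : R) : continuous_in I (fun _ => a) x.
Proof. apply filterlim_const. Qed.

End RealValued.

Lemma has_deriv_zero_eq (I : R -> Prop) (f : R -> R) :
  is_interval I -> forall a b, I a -> I b ->
  (forall t, I t -> Rmin a b <= t <= Rmax a b -> has_deriv I f t 0) -> f a = f b.
Proof.
intros HI.
assert (main : forall a b, I a -> I b -> a < b ->
   (forall t, a <= t <= b -> has_deriv I f t 0) -> f a = f b).
{ intros a b Ha Hb Hab Hf.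
  (* The retraction of the line onto [a, b]. [MVT_gen] asks for two-sided continuity at a and b,
     where [f] may be controlled from one side only; f o cl has it because [cl] is 1-Lipschitz with
     values in [I]. *)
  set (cl := fun t => Rmax a (Rmin b t)).
  assert (Hcl : forall t, a <= cl t <= b).
  { intros t; unfold cl; split; [apply Rmax_l | apply Rmax_lub; [lra | apply Rmin_l]]. }
  assert (Hid : forall t, a <= t <= b -> cl t = t).
  { intros t Ht; unfold cl; rewrite Rmin_right, Rmax_right; lra. }
  assert (Hcl1 : forall s t, Rabs (cl s - cl t) <= Rabs (s - t)).
  { intros s t; unfold cl, Rmax, Rmin.
    repeat destruct Rle_dec; unfold Rabs; repeat destruct Rcase_abs; lra. }
  destruct (MVT_gen (fun t => f (cl t)) a b (fun _ => 0)) as [c [_ Hc]].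
  - rewrite Rmin_left, Rmax_right by lra; intros t Ht.
    apply is_derive_ext_loc with f.
    { assert (He : 0 < Rmin (t - a) (b - t)) by (apply Rmin_pos; lra).
      exists (mkposreal _ He); intros y Hy.
      assert (Hy' : Rabs (y - t) < Rmin (t - a) (b - t)) by exact Hy.
      assert (H1 := Rmin_l (t - a) (b - t)); assert (H2 := Rmin_r (t - a) (b - t)).
      rewrite Hid; [reflexivity|]. apply Rabs_def2 in Hy'; lra. }
    assert (It : I t) by (apply (proj1 HI a b); auto; lra).
    destruct (Hf t) as [Hlin Hd]; [lra|].
    split; [exact Hlin|].
    intros z Hz.
    assert (Ez := is_filter_lim_locally_unique (K := R_AbsRing) (V := R_NormedModule) t z Hz); subst z.
    intros e; destruct (Hd t (within_locally_lim I t) e) as [d Hdd].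
    assert (He : 0 < Rmin d (Rmin (t - a) (b - t))) by (apply Rmin_pos; [apply cond_pos | apply Rmin_pos; lra]).
    exists (mkposreal _ He); intros y Hy.
    assert (Hy' : Rabs (y - t) < Rmin d (Rmin (t - a) (b - t))) by exact Hy.
    assert (H0 := Rmin_l d (Rmin (t - a) (b - t))); assert (H0' := Rmin_r d (Rmin (t - a) (b - t))).
    assert (H1 := Rmin_l (t - a) (b - t)); assert (H2 := Rmin_r (t - a) (b - t)).
    apply Hdd.
    + unfold ball; simpl; unfold AbsRing_ball; simpl.
      eapply Rlt_le_trans; [exact Hy' | exact H0].
    + apply Rabs_def2 in Hy'; apply (proj1 HI a b); auto; lra.
  - rewrite Rmin_left, Rmax_right by lra; intros t Ht.
    apply continuity_pt_filterlim.
    assert (Ic : I (cl t)) by (apply (proj1 HI a b); auto; apply Hcl).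
    assert (Hcont := has_deriv_continuous I (cl t) f 0 Ic (Hf _ (Hcl t))).
    intros P HP; destruct (Hcont P HP) as [d Hdd].
    exists d; intros y Hy; apply Hdd.
    + eapply Rle_lt_trans; [apply Hcl1 | exact Hy].
    + apply (proj1 HI a b); auto; apply Hcl.
  - rewrite !Hid in Hc; lra. }
intros a b Ha Hb Hf.
destruct (Rtotal_order a b) as [H|[->|H]]; [|reflexivity|symmetry];
  apply main; auto; intros t Ht; apply Hf.
- apply (proj1 HI a b); auto.
- rewrite Rmin_left, Rmax_right; lra.
- apply (proj1 HI b a); auto.
- rewrite Rmin_right, Rmax_left; lra.
Qed.

(** * Linear algebra in R^4 *)

Ltac unfold_R4 :=
  repeat match goal with p : _ |- _ =>
    first [ progress change (NormedModule.sort R_AbsRing R4) with (R * R * (R * R))%type in p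
          | match type of p with (_ * _)%type => destruct p end ] end;
  unfold dot, dotC, det4, det2, comb, scal, plus, minus, opp, zero; simpl;
  unfold scal, plus, minus, opp, mult, zero; simpl; unfold mult, plus; simpl.

(** A one-parameter group of isometries of R^4. By conversion, the twizzler is [rot m v] applied to
    its section v = 0, the curve (gamma, f) with f regarded as a complex number. *)
Definition rot (m v : R) (p : R4) : R4 := ((expi v * fst p)%C, (expi (m * v) * snd p)%C).

(* The generator of [rot m]: the derivative of [rot m v p] at [v = 0]. *)
Definition gen (m : R) (p : R4) : R4 :=
  ((- snd (fst p), fst (fst p)), (- (m * snd (snd p)), m * fst (snd p))).

(** The ternary vector product of R^4, obtained by expanding [det4] along its last row; up to length
    it is the normal of the surface in the sphere. *)
Definition cross (p q r : R4) : R4 :=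
  let p1 := fst (fst p) in let p2 := snd (fst p) in
  let p3 := fst (snd p) in let p4 := snd (snd p) in
  let q1 := fst (fst q) in let q2 := snd (fst q) in
  let q3 := fst (snd q) in let q4 := snd (snd q) in
  let r1 := fst (fst r) in let r2 := snd (fst r) in
  let r3 := fst (snd r) in let r4 := snd (snd r) in
  ((- (det2 p2 p3 q2 q3 * r4 - det2 p2 p4 q2 q4 * r3 + det2 p3 p4 q3 q4 * r2),
    det2 p1 p3 q1 q3 * r4 - det2 p1 p4 q1 q4 * r3 + det2 p3 p4 q3 q4 * r1),
   (- (det2 p1 p2 q1 q2 * r4 - det2 p1 p4 q1 q4 * r2 + det2 p2 p4 q2 q4 * r1),
    det2 p1 p2 q1 q2 * r3 - det2 p1 p3 q1 q3 * r2 + det2 p2 p3 q2 q3 * r1)).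

Lemma R4_ext (p q : R4) :
  fst (fst p) = fst (fst q) -> snd (fst p) = snd (fst q) ->
  fst (snd p) = fst (snd q) -> snd (snd p) = snd (snd q) -> p = q.
Proof.
destruct p as [[] []], q as [[] []]; simpl; intros; subst; reflexivity.
Qed.

Lemma dot_comm p q : dot p q = dot q p.
Proof. unfold_R4; ring. Qed.

Lemma dot_comb_l a b p q r : dot (comb a b p q) r = a * dot p r + b * dot q r.
Proof. unfold_R4; ring. Qed.

Lemma dot_comb_r a b p q r : dot r (comb a b p q) = a * dot r p + b * dot r q.
Proof. unfold_R4; ring. Qed.

Lemma dot_scal_l (a : R) (p q : R4) : dot (scal a p) q = a * dot p q.
Proof. unfold_R4; ring. Qed.

Lemma dot_scal_r (a : R) (p q : R4) : dot p (scal a q) = a * dot p q.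
Proof. unfold_R4; ring. Qed.

Lemma dot_minus_l (p q r : R4) : dot (minus p q) r = dot p r - dot q r.
Proof. unfold_R4; ring. Qed.

Lemma dot_minus_r (p q r : R4) : dot p (minus q r) = dot p q - dot p r.
Proof. unfold_R4; ring. Qed.

Lemma dot_gen_self m p : dot p (gen m p) = 0.
Proof. unfold gen; unfold_R4; ring. Qed.

Lemma dot_self_eq0 p : dot p p = 0 -> p = zero.
Proof.
intros H.
assert (fst (fst p) = 0 /\ snd (fst p) = 0 /\ fst (snd p) = 0 /\ snd (snd p) = 0) as (A & B & C & D).
{ revert H; unfold_R4; intros; repeat split; nra. }
destruct p as [[a b] [c d]]; simpl in *; subst; reflexivity.
Qed.

Lemma dot_self_ge0 p : 0 <= dot p p.
Proof. unfold_R4; nra. Qed.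

Lemma cos2_sin2 t : cos t * cos t + sin t * sin t = 1.
Proof. rewrite Rplus_comm; apply sin2_cos2. Qed.

Lemma dot_rot m v p q : dot (rot m v p) (rot m v q) = dot p q.
Proof.
transitivity ((cos v * cos v + sin v * sin v) * dotC (fst p) (fst q)
   + (cos (m * v) * cos (m * v) + sin (m * v) * sin (m * v)) * dotC (snd p) (snd q)).
- unfold rot, expi, Cmult; unfold_R4; ring.
- rewrite !cos2_sin2; unfold_R4; ring.
Qed.

Lemma det4_cross p q r s : det4 p q r s = dot (cross p q r) s.
Proof. unfold cross; unfold_R4; ring. Qed.

Lemma det4_rot m v p q r s :
  det4 (rot m v p) (rot m v q) (rot m v r) (rot m v s) = det4 p q r s.
Proof.
transitivity ((cos v * cos v + sin v * sin v)
   * (cos (m * v) * cos (m * v) + sin (m * v) * sin (m * v)) * det4 p q r s).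
- unfold rot, expi, Cmult; unfold_R4; ring.
- rewrite !cos2_sin2; ring.
Qed.

Lemma rot_zero m v : rot m v zero = zero.
Proof. apply dot_self_eq0; rewrite dot_rot; unfold dot, dotC, zero; simpl; unfold zero; simpl; ring. Qed.

Lemma rot_comb m v a b p q : rot m v (comb a b p q) = comb a b (rot m v p) (rot m v q).
Proof. unfold rot, expi, Cmult; apply R4_ext; unfold_R4; ring. Qed.

Definition gram2 (q r : R4) : R := dot q q * dot r r - dot q r ^ 2.

Lemma cross_orth p q r :
  dot (cross p q r) p = 0 /\ dot (cross p q r) q = 0 /\ dot (cross p q r) r = 0.
Proof. unfold cross; unfold_R4; repeat split; ring. Qed.

(** The squared length of the vector product is the Gram determinant of [p], [q], [r], expanded here
    along the row of [p], which is (1, 0, 0). *)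
Lemma cross_norm p q r :
  dot p p = 1 -> dot p q = 0 -> dot p r = 0 ->
  dot (cross p q r) (cross p q r) = gram2 q r.
Proof.
intros H1 H2 H3.
transitivity (dot p p * (dot q q * dot r r - dot q r ^ 2)
  - dot p q * (dot p q * dot r r - dot q r * dot p r)
  + dot p r * (dot p q * dot q r - dot q q * dot p r)).
- clear; unfold cross; unfold_R4; ring.
- rewrite H1, H2, H3; unfold gram2; ring.
Qed.

(** The square of a determinant is the Gram determinant of its rows; it is expanded along the row of
    [s], and orthogonality leaves a single product. *)
Lemma det4_sqr p q r s :
  dot p p = 1 -> dot p q = 0 -> dot p r = 0 ->
  dot s p = 0 -> dot s q = 0 -> dot s r = 0 ->
  det4 p q r s ^ 2 = gram2 q r * dot s s.
Proof.
intros Hpp Hpq Hpr Hsp Hsq Hsr.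
transitivity ((dot p p * (dot q q * dot r r - dot q r ^ 2)
  - dot p q * (dot p q * dot r r - dot q r * dot p r)
  + dot p r * (dot p q * dot q r - dot q q * dot p r)) * dot s s
  - (dot s p * (dot s p * (dot q q * dot r r - dot q r ^ 2)
               - dot s q * (dot p q * dot r r - dot q r * dot p r)
               + dot s r * (dot p q * dot q r - dot q q * dot p r))
   - dot s q * (dot s p * (dot p q * dot r r - dot p r * dot q r)
               - dot s q * (dot p p * dot r r - dot p r ^ 2)
               + dot s r * (dot p p * dot q r - dot p q * dot p r))
   + dot s r * (dot s p * (dot p q * dot q r - dot p r * dot q q)
               - dot s q * (dot p p * dot q r - dot p r * dot p q)
               + dot s r * (dot p p * dot q q - dot p q ^ 2)))).
- clear; unfold_R4; ring.
- rewrite Hpp, Hpq, Hpr, Hsp, Hsq, Hsr; unfold gram2; ring.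
Qed.

Lemma dot_minus_eq0 (p q : R4) : dot (minus p q) (minus p q) = 0 -> p = q.
Proof.
intros H; apply dot_self_eq0 in H.
assert (H1 := f_equal (fun w : R4 => fst (fst w)) H).
assert (H2 := f_equal (fun w : R4 => snd (fst w)) H).
assert (H3 := f_equal (fun w : R4 => fst (snd w)) H).
assert (H4 := f_equal (fun w : R4 => snd (snd w)) H).
clear H; revert H1 H2 H3 H4; unfold_R4; intros.
apply R4_ext; simpl; lra.
Qed.

(** Let d = [det4 p q r s]. Then d^2 = [gram2 q r], and positivity gives d = sqrt([gram2 q r]). Both
    cross.s = d and |cross|^2 = d^2, so |s - cross / d|^2 = 1 - 2 + 1 = 0, which determines [s]. *)
Lemma unit_normal_unique p q r s t :
  dot p p = 1 -> dot p q = 0 -> dot p r = 0 ->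
  dot s p = 0 -> dot s q = 0 -> dot s r = 0 -> dot s s = 1 -> 0 < det4 p q r s ->
  dot t p = 0 -> dot t q = 0 -> dot t r = 0 -> dot t t = 1 -> 0 < det4 p q r t ->
  s = t.
Proof.
assert (main : forall s, dot p p = 1 -> dot p q = 0 -> dot p r = 0 ->
  dot s p = 0 -> dot s q = 0 -> dot s r = 0 -> dot s s = 1 -> 0 < det4 p q r s ->
  s = scal (/ sqrt (gram2 q r)) (cross p q r)).
{ clear; intros s Hpp Hpq Hpr Hsp Hsq Hsr Hss Hdet.
  assert (Hd := det4_sqr p q r s Hpp Hpq Hpr Hsp Hsq Hsr).
  rewrite Hss, Rmult_1_r in Hd.
  assert (Hs : sqrt (gram2 q r) = det4 p q r s).
  { rewrite <- Hd; apply sqrt_pow2; lra. }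
  rewrite Hs.
  apply dot_minus_eq0.
  rewrite dot_minus_l, !dot_minus_r, !dot_scal_l, !dot_scal_r.
  rewrite (cross_norm p q r Hpp Hpq Hpr), (dot_comm s (cross p q r)), <- Hd, Hss.
  rewrite <- det4_cross; field; lra. }
intros; transitivity (scal (/ sqrt (gram2 q r)) (cross p q r)); [|symmetry]; auto.
Qed.

(** * Derivatives of curves in C and R^4, coordinate by coordinate *)

Lemma has_deriv_of_is_derive (I : R -> Prop) (f : R -> R) (x l : R) :
  I x -> is_derive f x l -> has_deriv I f x l.
Proof.
intros Hx Hf; pose proof (within_locally_proper I x Hx) as HP.
apply (filterdiff_locally (U := R_NormedModule) (V := R_NormedModule)
         (F := within I (locally x)) f x); [apply within_locally_lim | exact Hf].
Qed.

Lemma has_deriv_lincomb (I : R -> Prop) (a b : R) (f g : R -> R) (x l k : R) :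
  I x -> has_deriv I f x l -> has_deriv I g x k ->
  has_deriv I (fun y => a * f y + b * g y) x (a * l + b * k).
Proof.
intros Hx Hf Hg.
replace (a * l + b * k) with ((0 * f x + a * l) + (0 * g x + b * k)) by ring.
apply has_deriv_plus; apply has_deriv_mult; auto; apply has_deriv_const.
Qed.

Lemma is_derive_in_fst {V W : NormedModule R_AbsRing} (I : R -> Prop)
    (X : R -> prod_NormedModule R_AbsRing V W) x l :
  is_derive_in I X x l -> is_derive_in (V := V) I (fun y => fst (X y)) x (fst l).
Proof.
intros H; apply (is_derive_in_linear (V := prod_NormedModule R_AbsRing V W) (W := V) I x X l (fun t => fst t));
  [apply is_linear_fst | exact H].
Qed.

Lemma is_derive_in_snd {V W : NormedModule R_AbsRing} (I : R -> Prop)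
    (X : R -> prod_NormedModule R_AbsRing V W) x l :
  is_derive_in I X x l -> is_derive_in (V := W) I (fun y => snd (X y)) x (snd l).
Proof.
intros H; apply (is_derive_in_linear (V := prod_NormedModule R_AbsRing V W) (W := W) I x X l (fun t => snd t));
  [apply is_linear_snd | exact H].
Qed.

Lemma is_derive_in_C (I : R -> Prop) (X : R -> C) (x : R) (l : C) :
  is_derive_in (V := C_R_NormedModule) I X x l <->
  has_deriv I (fun y => fst (X y)) x (fst l) /\ has_deriv I (fun y => snd (X y)) x (snd l).
Proof.
split.
- intros H; split.
  + exact (is_derive_in_fst (V := R_NormedModule) (W := R_NormedModule) I X x l H).
  + exact (is_derive_in_snd (V := R_NormedModule) (W := R_NormedModule) I X x l H).
- intros [H1 H2].
  assert (H := is_derive_in_pair (V := R_NormedModule) (W := R_NormedModule) I x _ _ _ _ H1 H2).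
  unfold is_derive_in in *.
  rewrite (surjective_pairing l).
  eapply filterdiff_ext; [|exact H].
  intros y; symmetry; apply surjective_pairing.
Qed.

Lemma is_derive_in_R4 (I : R -> Prop) (X : R -> R4) (x : R) (l : R4) :
  is_derive_in I X x l <->
  (has_deriv I (fun y => fst (fst (X y))) x (fst (fst l)) /\
   has_deriv I (fun y => snd (fst (X y))) x (snd (fst l))) /\
  (has_deriv I (fun y => fst (snd (X y))) x (fst (snd l)) /\
   has_deriv I (fun y => snd (snd (X y))) x (snd (snd l))).
Proof.
split.
- intros H; split; apply is_derive_in_C.
  + exact (is_derive_in_fst (V := C_R_NormedModule) (W := C_R_NormedModule) I X x l H).
  + exact (is_derive_in_snd (V := C_R_NormedModule) (W := C_R_NormedModule) I X x l H).
- intros [H1 H2]; apply is_derive_in_C in H1, H2.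
  assert (H := is_derive_in_pair (V := C_R_NormedModule) (W := C_R_NormedModule) I x _ _ _ _ H1 H2).
  unfold is_derive_in in *.
  rewrite (surjective_pairing l).
  eapply filterdiff_ext; [|exact H].
  intros y; symmetry; apply surjective_pairing.
Qed.

Lemma Derive_in_correct {V : NormedModule R_AbsRing} (I : R -> Prop) (X : R -> V) (x : R) :
  ex_derive_in I X x -> is_derive_in I X x (Derive_in I X x).
Proof. intros H; unfold Derive_in; apply epsilon_spec; exact H. Qed.

Lemma Derive_in_unique_C (I : R -> Prop) (X : R -> C) (x : R) (l : C) :
  is_interval I -> I x -> is_derive_in (V := C_R_NormedModule) I X x l ->
  Derive_in (V := C_R_NormedModule) I X x = l.
Proof.
intros HI Hx H.
assert (H' := Derive_in_correct (V := C_R_NormedModule) I X x (ex_intro _ l H)).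
apply is_derive_in_C in H, H'.
destruct H as [H1 H2], H' as [K1 K2].
apply injective_projections.
- exact (has_deriv_unique I x _ _ _ HI Hx K1 H1).
- exact (has_deriv_unique I x _ _ _ HI Hx K2 H2).
Qed.

Lemma Derive_in_unique_R4 (I : R -> Prop) (X : R -> R4) (x : R) (l : R4) :
  is_interval I -> I x -> is_derive_in I X x l -> Derive_in I X x = l.
Proof.
intros HI Hx H.
assert (H' := Derive_in_correct I X x (ex_intro _ l H)).
apply is_derive_in_R4 in H, H'.
destruct H as [[H1 H2] [H3 H4]], H' as [[K1 K2] [K3 K4]].
apply R4_ext.
- exact (has_deriv_unique I x _ _ _ HI Hx K1 H1).
- exact (has_deriv_unique I x _ _ _ HI Hx K2 H2).
- exact (has_deriv_unique I x _ _ _ HI Hx K3 H3).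
- exact (has_deriv_unique I x _ _ _ HI Hx K4 H4).
Qed.

Lemma whole_line_interval : is_interval whole_line.
Proof. split; [easy | exists 0, 1; repeat split; lra]. Qed.

Lemma has_deriv_dot (I : R -> Prop) (X Y : R -> R4) (x : R) (k l : R4) :
  I x -> is_derive_in I X x k -> is_derive_in I Y x l ->
  has_deriv I (fun t => dot (X t) (Y t)) x (dot k (Y x) + dot (X x) l).
Proof.
intros Hx HX HY; apply is_derive_in_R4 in HX, HY.
destruct HX as [[X1 X2] [X3 X4]], HY as [[Y1 Y2] [Y3 Y4]].
assert (H := has_deriv_plus _ _ _ _ _ _
  (has_deriv_plus _ _ _ _ _ _ (has_deriv_mult _ _ _ _ _ _ Hx X1 Y1) (has_deriv_mult _ _ _ _ _ _ Hx X2 Y2))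
  (has_deriv_plus _ _ _ _ _ _ (has_deriv_mult _ _ _ _ _ _ Hx X3 Y3) (has_deriv_mult _ _ _ _ _ _ Hx X4 Y4))).
simpl in H.
replace (dot k (Y x) + dot (X x) l) with
  (fst (fst k) * fst (fst (Y x)) + fst (fst (X x)) * fst (fst l) +
      (snd (fst k) * snd (fst (Y x)) + snd (fst (X x)) * snd (fst l)) +
      (fst (snd k) * fst (snd (Y x)) + fst (snd (X x)) * fst (snd l) +
       (snd (snd k) * snd (snd (Y x)) + snd (snd (X x)) * snd (snd l)))).
- exact H.
- clear; unfold dot, dotC; ring.
Qed.

Lemma has_deriv_eq (I : R -> Prop) (f g : R -> R) (x l k : R) :
  I x -> has_deriv I f x l -> (forall t, f t = g t) -> l = k -> has_deriv I g x k.
Proof.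
intros Hx Hf E <-; apply (is_derive_in_ext (V := R_NormedModule) I x f g l Hx); auto.
Qed.

Lemma is_derive_in_rot (I : R -> Prop) (m v : R) (X : R -> R4) (x : R) (l : R4) :
  I x -> is_derive_in I X x l -> is_derive_in I (fun t => rot m v (X t)) x (rot m v l).
Proof.
intros Hx H; apply is_derive_in_R4 in H; apply is_derive_in_R4.
destruct H as [[H1 H2] [H3 H4]].
split; split.
- eapply (has_deriv_eq _ _ _ _ _ _ Hx (has_deriv_lincomb I (cos v) (- sin v) _ _ _ _ _ Hx H1 H2));
    [intros t; destruct (X t) as [[] []] | destruct l as [[] []]]; simpl; ring.
- eapply (has_deriv_eq _ _ _ _ _ _ Hx (has_deriv_lincomb I (cos v) (sin v) _ _ _ _ _ Hx H2 H1));
    [intros t; destruct (X t) as [[] []] | destruct l as [[] []]]; simpl; ring.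
- eapply (has_deriv_eq _ _ _ _ _ _ Hx (has_deriv_lincomb I (cos (m*v)) (- sin (m*v)) _ _ _ _ _ Hx H3 H4));
    [intros t; destruct (X t) as [[] []] | destruct l as [[] []]]; simpl; ring.
- eapply (has_deriv_eq _ _ _ _ _ _ Hx (has_deriv_lincomb I (cos (m*v)) (sin (m*v)) _ _ _ _ _ Hx H4 H3));
    [intros t; destruct (X t) as [[] []] | destruct l as [[] []]]; simpl; ring.
Qed.

Lemma is_derive_in_rot_angle (I : R -> Prop) (m v : R) (p : R4) :
  I v -> is_derive_in I (fun t => rot m t p) v (rot m v (gen m p)).
Proof.
intros Hv; apply is_derive_in_R4; simpl.
split; split; apply has_deriv_of_is_derive; auto; auto_derive; auto; ring.
Qed.

Lemma is_derive_in_scal (I : R -> Prop) (a : R -> R) (X : R -> R4) (x k : R) (l : R4) :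
  I x -> has_deriv I a x k -> is_derive_in I X x l ->
  is_derive_in I (fun t => (scal (a t) (X t) : R4)) x (plus (scal k (X x)) (scal (a x) l)).
Proof.
intros Hx Ha HX; apply is_derive_in_R4 in HX; apply is_derive_in_R4.
destruct HX as [[H1 H2] [H3 H4]].
split; split; apply has_deriv_mult; auto.
Qed.

(** * Surfaces swept out by a one-parameter group *)

(** The classical formula (L G - 2 M F + N E) / (E G - F^2) for the trace of the second fundamental
    form. Let A have the columns (a1, b1), (a2, b2), let Q be the matrix of E, F, G and d = det A.
    Orthonormality is A^T Q A = 1. Hence Q A is the inverse transpose of A, which is read entry by
    entry in [Ea1] to [Eb2], and A A^T is the inverse of Q, which is read in [Saa], [Sbb], [Sab]
    with d^2 in place of 1 / det Q. *)
Lemma trace_in_orthonormal_frame (E F G L M N a1 b1 a2 b2 : R) :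
  E * a1 ^ 2 + 2 * F * (a1 * b1) + G * b1 ^ 2 = 1 ->
  E * a2 ^ 2 + 2 * F * (a2 * b2) + G * b2 ^ 2 = 1 ->
  E * (a1 * a2) + F * (a1 * b2 + a2 * b1) + G * (b1 * b2) = 0 ->
  (E * G - F ^ 2) * (L * (a1 ^ 2 + a2 ^ 2) + 2 * M * (a1 * b1 + a2 * b2) + N * (b1 ^ 2 + b2 ^ 2))
  = L * G - 2 * M * F + N * E.
Proof.
intros H1 H2 H12.
set (d := a1 * b2 - a2 * b1).
assert (Hd : d ^ 2 * (E * G - F ^ 2) = 1).
{ transitivity ((E * a1 ^ 2 + 2 * F * (a1 * b1) + G * b1 ^ 2) * (E * a2 ^ 2 + 2 * F * (a2 * b2) + G * b2 ^ 2)
    - (E * (a1 * a2) + F * (a1 * b2 + a2 * b1) + G * (b1 * b2)) ^ 2); [unfold d; ring|].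
  rewrite H1, H2, H12; ring. }
set (q1 := E * a1 ^ 2 + 2 * F * (a1 * b1) + G * b1 ^ 2) in H1.
set (q2 := E * a2 ^ 2 + 2 * F * (a2 * b2) + G * b2 ^ 2) in H2.
set (q := E * (a1 * a2) + F * (a1 * b2 + a2 * b1) + G * (b1 * b2)) in H12.
assert (Ea1 : a1 = d * (F * a2 + G * b2)).
{ transitivity (a1 * q2 - a2 * q); [rewrite H2, H12; ring | unfold q2, q, d; ring]. }
assert (Ea2 : a2 = - d * (F * a1 + G * b1)).
{ transitivity (a2 * q1 - a1 * q); [rewrite H1, H12; ring | unfold q1, q, d; ring]. }
assert (Eb1 : b1 = - d * (E * a2 + F * b2)).
{ transitivity (b1 * q2 - b2 * q); [rewrite H2, H12; ring | unfold q2, q, d; ring]. }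
assert (Eb2 : b2 = d * (E * a1 + F * b1)).
{ transitivity (b2 * q1 - b1 * q); [rewrite H1, H12; ring | unfold q1, q, d; ring]. }
assert (Saa : a1 ^ 2 + a2 ^ 2 = G * d ^ 2).
{ transitivity (a1 * (d * (F * a2 + G * b2)) + a2 * (- d * (F * a1 + G * b1)));
  [rewrite <- Ea1, <- Ea2; ring | unfold d; ring]. }
assert (Sbb : b1 ^ 2 + b2 ^ 2 = E * d ^ 2).
{ transitivity (b1 * (- d * (E * a2 + F * b2)) + b2 * (d * (E * a1 + F * b1)));
  [rewrite <- Eb1, <- Eb2; ring | unfold d; ring]. }
assert (Sab : a1 * b1 + a2 * b2 = - F * d ^ 2).
{ transitivity (b1 * (d * (F * a2 + G * b2)) + b2 * (- d * (F * a1 + G * b1)));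
  [rewrite <- Ea1, <- Ea2; ring | unfold d; ring]. }
rewrite Saa, Sbb, Sab.
transitivity ((L * G - 2 * M * F + N * E) * (d ^ 2 * (E * G - F ^ 2))); [ring | rewrite Hd; ring].
Qed.

(** [K] will be differentiability and, later, continuity at a point. The coordinates of [gen], [rot]
    and [cross] are polynomial in those of their arguments, so closure under ring operations treats
    both cases at once. *)
Record function_algebra (K : (R -> R) -> Prop) : Prop := {
  fa_const : forall a : R, K (fun _ => a);
  fa_opp : forall f, K f -> K (fun t => - f t);
  fa_plus : forall f g, K f -> K g -> K (fun t => f t + g t);
  fa_mult : forall f g, K f -> K g -> K (fun t => f t * g t) }.

Definition coords_in (K : (R -> R) -> Prop) (X : R -> R4) : Prop :=
  (K (fun t => fst (fst (X t))) /\ K (fun t => snd (fst (X t)))) /\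
  (K (fun t => fst (snd (X t))) /\ K (fun t => snd (snd (X t)))).

Ltac in_algebra HK :=
  unfold Rminus; repeat first
    [ assumption | apply (fa_plus _ HK) | apply (fa_mult _ HK)
    | apply (fa_opp _ HK) | apply (fa_const _ HK) ].

Lemma coords_in_cross K X Y Z :
  function_algebra K -> coords_in K X -> coords_in K Y -> coords_in K Z ->
  coords_in K (fun t => cross (X t) (Y t) (Z t)).
Proof.
intros HK [[] []] [[] []] [[] []].
split; split; unfold cross, det2; simpl; in_algebra HK.
Qed.

Lemma coords_in_gen K m X :
  function_algebra K -> coords_in K X -> coords_in K (fun t => gen m (X t)).
Proof. intros HK [[] []]; split; split; unfold gen; simpl; in_algebra HK. Qed.

Lemma coords_in_rot K m v X :
  function_algebra K -> coords_in K X -> coords_in K (fun t => rot m v (X t)).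
Proof. intros HK [[] []]; split; split; unfold rot, expi, Cmult; simpl; in_algebra HK. Qed.

Lemma fa_dot K X Y :
  function_algebra K -> coords_in K X -> coords_in K Y -> K (fun t => dot (X t) (Y t)).
Proof. intros HK [[] []] [[] []]; unfold dot, dotC; in_algebra HK. Qed.

Lemma fa_gram2 K X Y :
  function_algebra K -> coords_in K X -> coords_in K Y -> K (fun t => gram2 (X t) (Y t)).
Proof.
intros HK HX HY; unfold gram2, pow.
assert (A := fa_dot K X X HK HX HX); assert (B := fa_dot K Y Y HK HY HY).
assert (C := fa_dot K X Y HK HX HY).
in_algebra HK.
Qed.

Lemma function_algebra_ex_deriv I x :
  I x -> function_algebra (fun f => exists l, has_deriv I f x l).
Proof.
intros Hx; split.
- intros a; exists 0; apply has_deriv_const.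
- intros f [l Hl]; exists (- l).
  apply (has_deriv_eq I _ _ x _ _ Hx (has_deriv_lincomb I (-1) 0 f f x l l Hx Hl Hl)); intros; ring.
- intros f g [l Hl] [k Hk]; eexists; apply has_deriv_plus; eauto.
- intros f g [l Hl] [k Hk]; eexists; apply has_deriv_mult; eauto.
Qed.

Lemma function_algebra_continuous I x : function_algebra (fun f => continuous_in I f x).
Proof.
split.
- intros a; apply continuous_in_const.
- intros f Hf; apply (continuous_in_comp I x f Ropp Hf), (continuous_opp (V := R_NormedModule)), continuous_id.
- intros; apply continuous_in_plus; auto.
- intros; apply continuous_in_mult; auto.
Qed.

Lemma ex_derive_in_R4 I X x :
  ex_derive_in (V := R4) I X x <-> coords_in (fun f => exists l, has_deriv I f x l) X.
Proof.
split.
- intros [l Hl]; apply is_derive_in_R4 in Hl; destruct Hl as [[] []]; split; split; eauto.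
- intros [[[a Ha] [b Hb]] [[c Hc] [d Hd]]]; exists ((a, b), (c, d)).
  apply is_derive_in_R4; simpl; auto.
Qed.

Lemma has_deriv_inv_sqrt I (f : R -> R) x l :
  I x -> has_deriv I f x l -> 0 < f x ->
  has_deriv I (fun t => / sqrt (f t)) x (- l / (2 * f x * sqrt (f x))).
Proof.
intros Hx Hf Hpos.
assert (Hs := sqrt_lt_R0 _ Hpos).
assert (Hd : is_derive (fun y => / sqrt y) (f x) (- / (2 * f x * sqrt (f x)))).
{ auto_derive; [split; [|split]; auto; lra|].
  rewrite <- (sqrt_sqrt (f x)) at 4 by lra; field; lra. }
eapply has_deriv_eq; [exact Hx | exact (has_deriv_comp I x f _ l _ Hx Hf Hd) | reflexivity |].
field; lra.
Qed.

Lemma is_derive_in_gen (I : R -> Prop) (m : R) (X : R -> R4) (x : R) (l : R4) :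
  I x -> is_derive_in I X x l -> is_derive_in I (fun t => gen m (X t)) x (gen m l).
Proof.
intros Hx H; apply is_derive_in_R4 in H; apply is_derive_in_R4.
destruct H as [[H1 H2] [H3 H4]]; split; split; simpl.
- eapply has_deriv_eq; [exact Hx |
    exact (has_deriv_lincomb I (-1) 0 _ _ _ _ _ Hx H2 H2) | |]; intros; simpl; ring.
- exact H1.
- eapply has_deriv_eq; [exact Hx |
    exact (has_deriv_lincomb I (-m) 0 _ _ _ _ _ Hx H4 H4) | |]; intros; simpl; ring.
- eapply has_deriv_eq; [exact Hx |
    exact (has_deriv_lincomb I m 0 _ _ _ _ _ Hx H3 H3) | |]; intros; simpl; ring.
Qed.

(* Differentiating [nu . X = 0] turns derivatives of [nu] into derivatives of [X]. *)
Lemma dot_deriv_orth (J : R -> Prop) (X Y : R -> R4) (x : R) (k l : R4) :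
  is_interval J -> J x -> is_derive_in J X x k -> is_derive_in J Y x l ->
  (forall t, J t -> dot (X t) (Y t) = 0) -> dot k (Y x) = - dot (X x) l.
Proof.
intros HJ Hx HX HY H0.
assert (H := has_deriv_dot J X Y x _ _ Hx HX HY).
assert (H1 : has_deriv J (fun t => dot (X t) (Y t)) x 0).
{ apply (is_derive_in_ext (V := R_NormedModule) J x (fun _ => 0)); auto.
  - intros y Hy; symmetry; auto.
  - apply has_deriv_const. }
assert (E := has_deriv_unique J x _ _ _ HJ Hx H H1); lra.
Qed.

(* [- nu . (G T_uu - 2 F T_uv + E T_vv) / g] with [nu = cross T T_u T_v / sqrt g],
   evaluated at [v = 0]. *)
Definition twizzled_mean_curvature (m : R) (p p1 p2 : R4) : R :=
  let n := cross p p1 (gen m p) in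
  let g := gram2 p1 (gen m p) in
  - (dot n p2 * dot (gen m p) (gen m p)
     - 2 * dot n (gen m p1) * dot p1 (gen m p)
     + dot n (gen m (gen m p)) * dot p1 p1) / (g * sqrt g).

Section TwizzledSurface.
Variables (I : R -> Prop) (m : R) (P P1 P2 : R -> R4).
Hypothesis HI : is_interval I.
Hypothesis HP : forall u, I u -> is_derive_in I P u (P1 u).
Hypothesis HP1 : forall u, I u -> is_derive_in I P1 u (P2 u).
Hypothesis HS : forall u, I u -> dot (P u) (P u) = 1.

Let T : R -> R -> R4 := fun u v => rot m v (P u).

Hypothesis Himm : immersion_on I T.

Lemma d_u_twizzled u v : I u -> d_u I T u v = rot m v (P1 u).
Proof.
intros Hu; apply Derive_in_unique_R4; auto.
apply is_derive_in_rot; auto.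
Qed.

Lemma d_v_twizzled u v : d_v T u v = rot m v (gen m (P u)).
Proof.
apply Derive_in_unique_R4; [apply whole_line_interval | easy |].
apply is_derive_in_rot_angle; easy.
Qed.

Lemma metric_det_twizzled u v : I u -> metric_det I T u v = gram2 (P1 u) (gen m (P u)).
Proof.
intros Hu; unfold metric_det; rewrite d_u_twizzled, d_v_twizzled, !dot_rot; auto.
Qed.

Lemma dot_P_P1 u : I u -> dot (P u) (P1 u) = 0.
Proof.
intros Hu.
assert (H := has_deriv_dot I P P u _ _ Hu (HP u Hu) (HP u Hu)).
assert (H0 : has_deriv I (fun t => dot (P t) (P t)) u 0).
{ apply (is_derive_in_ext (V := R_NormedModule) I u (fun _ => 1)); auto.
  - intros y Hy; symmetry; auto.
  - apply has_deriv_const. }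
assert (E := has_deriv_unique I u _ _ _ HI Hu H H0).
rewrite (dot_comm (P1 u)) in E; lra.
Qed.

Lemma gram2_pos u : I u -> 0 < gram2 (P1 u) (gen m (P u)).
Proof.
intros Hu.
assert (Hker : forall a b, comb a b (P1 u) (gen m (P u)) = zero -> a = 0 /\ b = 0).
{ intros a b Hab; apply (Himm u 0 Hu).
  rewrite d_u_twizzled, d_v_twizzled by auto.
  rewrite <- rot_comb, Hab; apply rot_zero. }
set (q := P1 u) in *; set (r := gen m (P u)) in *.
assert (Hr : 0 < dot r r).
{ destruct (Rle_lt_or_eq_dec _ _ (dot_self_ge0 r)) as [H|H]; [exact H|exfalso].
  destruct (Hker 0 1) as [_ H1]; [|lra].
  apply dot_self_eq0; rewrite dot_comb_l, !dot_comb_r, <- H; ring. }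
(* This is [dot r r] times the component of [q] orthogonal to [r]. Its squared length is [dot r r]
   times the Gram determinant, and its coefficient at [q] is nonzero. *)
set (w := comb (dot r r) (- dot q r) q r).
assert (Hw : dot w w = dot r r * gram2 q r).
{ unfold w, gram2; rewrite dot_comb_l, !dot_comb_r, (dot_comm r q); ring. }
assert (Hw0 : 0 < dot w w).
{ destruct (Rle_lt_or_eq_dec _ _ (dot_self_ge0 w)) as [H|H]; [exact H|exfalso].
  destruct (Hker _ _ (dot_self_eq0 w (eq_sym H))); lra. }
rewrite Hw in Hw0; nra.
Qed.

Let n u := cross (P u) (P1 u) (gen m (P u)).
Let g u := gram2 (P1 u) (gen m (P u)).

Definition twizzled_normal (u v : R) : R4 := scal (/ sqrt (g u)) (rot m v (n u)).

Lemma twizzled_normal_unit : is_unit_normal I T twizzled_normal.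
Proof.
intros u v Hu.
assert (Hg := gram2_pos u Hu); fold (g u) in Hg.
assert (Hs := sqrt_lt_R0 _ Hg).
rewrite d_u_twizzled, d_v_twizzled by auto.
unfold twizzled_normal, T.
rewrite !dot_scal_l, !dot_scal_r, det4_cross, dot_scal_r, <- det4_cross, det4_rot, det4_cross, !dot_rot.
destruct (cross_orth (P u) (P1 u) (gen m (P u))) as (H1 & H2 & H3).
unfold n; rewrite H1, H2, H3.
rewrite cross_norm by (auto using dot_P_P1, dot_gen_self).
fold (g u); repeat split; try ring.
- rewrite <- (sqrt_sqrt (g u)) at 3 by lra; field; lra.
- apply Rmult_lt_0_compat; [apply Rinv_0_lt_compat|]; auto.
Qed.

(** The definition of mean curvature provides some unit normal field about which nothing else is
    known; the sign condition on [det4] identifies it with the explicit one. *)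
Lemma unit_normal_twizzled nu u v : is_unit_normal I T nu -> I u -> nu u v = twizzled_normal u v.
Proof.
intros Hnu Hu.
destruct (Hnu u v Hu) as (A1 & A2 & A3 & A4 & A5).
destruct (twizzled_normal_unit u v Hu) as (B1 & B2 & B3 & B4 & B5).
apply (unit_normal_unique (T u v) (d_u I T u v) (d_v T u v)); auto.
- unfold T; rewrite dot_rot; auto.
- rewrite d_u_twizzled by auto; unfold T; rewrite dot_rot; auto using dot_P_P1.
- rewrite d_v_twizzled; unfold T; rewrite dot_rot; apply dot_gen_self.
Qed.

Lemma dot_twizzled_normal_rot u v w :
  dot (twizzled_normal u v) (rot m v w) = dot (n u) w / sqrt (g u).
Proof. unfold twizzled_normal; rewrite dot_scal_l, dot_rot; unfold Rdiv; ring. Qed.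

(** The relations nu.T_u = 0 and nu.T_v = 0 are each differentiated in u and in v, so no formula for
    the derivatives of [nu] is required. The two mixed entries agree because both T_uv and T_vu are
    [rot m v (gen m (P1 u))]. *)
Lemma second_fundamental_form nu u v :
  is_unit_normal I T nu -> I u ->
  ex_derive_in I (fun x => nu x v) u -> ex_derive_in whole_line (fun y => nu u y) v ->
  let s := sqrt (g u) in
  dot (d_u I nu u v) (rot m v (P1 u)) = - (dot (n u) (P2 u) / s) /\
  dot (d_u I nu u v) (rot m v (gen m (P u))) = - (dot (n u) (gen m (P1 u)) / s) /\
  dot (d_v nu u v) (rot m v (P1 u)) = - (dot (n u) (gen m (P1 u)) / s) /\
  dot (d_v nu u v) (rot m v (gen m (P u))) = - (dot (n u) (gen m (gen m (P u))) / s).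
Proof.
intros Hnu Hu Hdu Hdv s.
apply Derive_in_correct in Hdu; apply Derive_in_correct in Hdv.
fold (d_u I nu u v) in Hdu; fold (d_v nu u v) in Hdv.
unfold s; rewrite <- !(dot_twizzled_normal_rot u v), <- !(unit_normal_twizzled nu u v) by auto.
assert (Hgen := is_derive_in_gen I m P u _ Hu (HP u Hu)).
repeat split.
- apply (dot_deriv_orth I (fun x => nu x v) (fun x => rot m v (P1 x)) u); auto.
  + apply is_derive_in_rot; auto.
  + intros t Ht; rewrite <- d_u_twizzled by auto; apply (Hnu t v Ht).
- apply (dot_deriv_orth I (fun x => nu x v) (fun x => rot m v (gen m (P x))) u); auto.
  + apply is_derive_in_rot; auto.
  + intros t Ht; rewrite <- d_v_twizzled; apply (Hnu t v Ht).
- apply (dot_deriv_orth whole_line (fun y => nu u y) (fun y => rot m y (P1 u)) v);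
    auto using whole_line_interval; try easy.
  + apply is_derive_in_rot_angle; easy.
  + intros t _; rewrite <- d_u_twizzled by auto; apply (Hnu u t Hu).
- apply (dot_deriv_orth whole_line (fun y => nu u y) (fun y => rot m y (gen m (P u))) v);
    auto using whole_line_interval; try easy.
  + apply is_derive_in_rot_angle; easy.
  + intros t _; rewrite <- d_v_twizzled; apply (Hnu u t Hu).
Qed.

Lemma mean_curvature_trace nu u v a1 b1 a2 b2 :
  is_unit_normal I T nu -> I u ->
  ex_derive_in I (fun x => nu x v) u -> ex_derive_in whole_line (fun y => nu u y) v ->
  let f1 := comb a1 b1 (d_u I T u v) (d_v T u v) in
  let f2 := comb a2 b2 (d_u I T u v) (d_v T u v) in
  dot f1 f1 = 1 -> dot f2 f2 = 1 -> dot f1 f2 = 0 ->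
  dot (cov_deriv I T nu u v a1 b1) f1 + dot (cov_deriv I T nu u v a2 b2) f2
  = twizzled_mean_curvature m (P u) (P1 u) (P2 u).
Proof.
intros Hnu Hu Hdu Hdv.
destruct (second_fundamental_form nu u v Hnu Hu Hdu Hdv) as (HL & HM & HM' & HN).
cbv zeta.
assert (Hg := gram2_pos u Hu); fold (g u) in Hg.
assert (Hs := sqrt_lt_R0 _ Hg).
unfold cov_deriv; cbv zeta; change (T u v) with (rot m v (P u)).
rewrite !dot_minus_l, !dot_scal_l.
rewrite d_u_twizzled, d_v_twizzled by auto.
(* Tangent vectors of T are orthogonal to T, so the projection in [cov_deriv] does not affect these
   inner products. *)
assert (HT : forall a b, dot (rot m v (P u)) (comb a b (rot m v (P1 u)) (rot m v (gen m (P u)))) = 0).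
{ intros a b; rewrite dot_comb_r, !dot_rot, dot_P_P1, dot_gen_self by auto; ring. }
rewrite !HT.
rewrite !dot_comb_l, !dot_comb_r, !dot_rot, HL, HM, HM', HN.
intros H1 H2 H12.
unfold twizzled_mean_curvature; fold (n u) (g u).
set (s := sqrt (g u)) in *.
rewrite (dot_comm (gen m (P u)) (P1 u)) in *.
set (E := dot (P1 u) (P1 u)) in *; set (F := dot (P1 u) (gen m (P u))) in *.
set (G := dot (gen m (P u)) (gen m (P u))) in *.
assert (Htr := trace_in_orthonormal_frame E F G (dot (n u) (P2 u)) (dot (n u) (gen m (P1 u)))
   (dot (n u) (gen m (gen m (P u)))) a1 b1 a2 b2).
change (E * G - F ^ 2) with (g u) in Htr.
match goal with |- ?l = - ?num / _ =>
  assert (Hk : g u * s * l = - num) end.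
{ transitivity (- (dot (n u) (P2 u) * G - 2 * dot (n u) (gen m (P1 u)) * F
      + dot (n u) (gen m (gen m (P u))) * E)); [|ring].
  rewrite <- Htr; [field; lra | rewrite <- H1; ring | rewrite <- H2; ring | rewrite <- H12; ring]. }
match goal with |- ?l = _ => apply Rmult_eq_reg_l with (g u * s); [rewrite Hk; field; lra | nra] end.
Qed.

(** [is_mean_curvature] quantifies over orthonormal frames, so it determines a value only once a
    frame is exhibited. Gram-Schmidt applied to T_u, T_v gives T_u / e and (E T_v - F T_u) / (e d),
    with e = sqrt E and d = sqrt g. *)
Lemma mean_curvature_unique u v k :
  I u -> is_mean_curvature I T u v k -> k = twizzled_mean_curvature m (P u) (P1 u) (P2 u).
Proof.
intros Hu [nu (Hnu & Hdu & Hdv & Hk)].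
assert (Hg := gram2_pos u Hu).
set (E := dot (P1 u) (P1 u)); set (F := dot (P1 u) (gen m (P u))).
set (G := dot (gen m (P u)) (gen m (P u))).
set (D := gram2 (P1 u) (gen m (P u))) in *.
assert (HE : 0 < E).
{ assert (0 <= E) by apply dot_self_ge0.
  assert (0 <= G) by apply dot_self_ge0.
  assert (D = E * G - F ^ 2) by reflexivity.
  destruct (Req_dec E 0) as [E0|E0]; nra. }
assert (HsE := sqrt_lt_R0 _ HE); assert (HsD := sqrt_lt_R0 _ Hg).
assert (QE := sqrt_sqrt E (Rlt_le _ _ HE)); assert (QD := sqrt_sqrt D (Rlt_le _ _ Hg)).
set (e := sqrt E) in *; set (d := sqrt D) in *.
assert (HD : D = E * G - F ^ 2) by reflexivity.
assert (Hframe : forall a b c d', dot (comb a b (d_u I T u v) (d_v T u v)) (comb c d' (d_u I T u v) (d_v T u v))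
   = E * (a * c) + F * (a * d' + b * c) + G * (b * d')).
{ intros; rewrite d_u_twizzled, d_v_twizzled by auto.
  rewrite dot_comb_l, !dot_comb_r, !dot_rot, (dot_comm (gen m (P u)) (P1 u)).
  unfold E, F, G; ring. }
assert (F1 : E * (/ e * / e) + F * (/ e * 0 + 0 * / e) + G * (0 * 0) = 1).
{ rewrite <- QE; field; lra. }
assert (F2 : E * ((- F / (e * d)) * (- F / (e * d))) + F * ((- F / (e * d)) * (E / (e * d)) + (E / (e * d)) * (- F / (e * d)))
    + G * ((E / (e * d)) * (E / (e * d))) = 1).
{ transitivity (E * (E * G - F ^ 2) / ((e * e) * (d * d))); [field; lra|].
  rewrite <- HD, QE, QD; field; lra. }
assert (F12 : E * (/ e * (- F / (e * d))) + F * (/ e * (E / (e * d)) + 0 * (- F / (e * d)))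
    + G * (0 * (E / (e * d))) = 0) by (field; lra).
rewrite (Hk (/ e) 0 (- F / (e * d)) (E / (e * d))); [|rewrite Hframe; assumption ..].
apply mean_curvature_trace; auto; rewrite Hframe; assumption.
Qed.

(** For existence the explicit normal is the witness. In u it is polynomial in [P] and [P1] up to
    the factor 1 / sqrt g, hence differentiable because [P1] is; in v it merely rotates. *)
Lemma mean_curvature_iff u v k :
  I u ->
  (is_mean_curvature I T u v k <-> k = twizzled_mean_curvature m (P u) (P1 u) (P2 u)).
Proof.
intros Hu; split; [apply mean_curvature_unique, Hu|].
intros ->.
assert (HK := function_algebra_ex_deriv I u Hu).
assert (Hc : coords_in (fun f => exists l, has_deriv I f u l) P).
{ apply ex_derive_in_R4; exists (P1 u); auto. }
assert (Hc1 : coords_in (fun f => exists l, has_deriv I f u l) P1).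
{ apply ex_derive_in_R4; exists (P2 u); auto. }
assert (Hcg := coords_in_gen _ m P HK Hc).
assert (Hdu : ex_derive_in I (fun x => twizzled_normal x v) u).
{ destruct (fa_gram2 _ _ _ HK Hc1 Hcg) as [l Hl].
  destruct (proj2 (ex_derive_in_R4 _ _ _)
    (coords_in_rot _ m v _ HK (coords_in_cross _ _ _ _ HK Hc Hc1 Hcg))) as [k Hk].
  eexists; apply is_derive_in_scal; [exact Hu | | exact Hk].
  apply has_deriv_inv_sqrt; [exact Hu | exact Hl | apply gram2_pos, Hu]. }
assert (Hdv : ex_derive_in whole_line (fun y => twizzled_normal u y) v).
{ eexists; apply is_derive_in_scal; [easy | apply has_deriv_const | apply is_derive_in_rot_angle; easy]. }
exists twizzled_normal; split; [apply twizzled_normal_unit|].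
split; [exact Hdu | split; [exact Hdv|]].
intros a1 b1 a2 b2 f1 f2 H1 H2 H12; symmetry.
apply mean_curvature_trace; auto using twizzled_normal_unit.
Qed.

End TwizzledSurface.

(** * The conserved momentum *)

Definition emb (q : CxR) : R4 := (fst q, RtoC (snd q)).

Lemma is_derive_in_emb (I : R -> Prop) (q : R -> CxR) (x : R) (l : CxR) :
  is_derive_in I q x l -> is_derive_in I (fun t => emb (q t)) x (emb l).
Proof.
intros H; apply is_derive_in_R4.
assert (H1 := is_derive_in_fst (V := C_R_NormedModule) (W := R_NormedModule) I q x l H).
assert (H2 := is_derive_in_snd (V := C_R_NormedModule) (W := R_NormedModule) I q x l H).
apply is_derive_in_C in H1.
destruct H1 as [H1 H1'].
split; split.
- exact H1.
- exact H1'.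
- exact H2.
- exact (has_deriv_const I x 0).
Qed.

(* The profile curve is [q = (gamma, f)]; [q1] and [q2] stand for its derivatives. *)
Definition axial (q q1 : CxR) : R := dotC (fst q1) (Ci * fst q)%C.

Definition momentum (m : R) (q q1 : CxR) : R :=
  m * snd q ^ 2 * axial q q1 / sqrt (gram2 (emb q1) (gen m (emb q))).

Definition twizzler_mean_curvature (m : R) (q q1 q2 : CxR) : R :=
  twizzled_mean_curvature m (emb q) (emb q1) (emb q2).

(** In the second factor, i m f is orthogonal to the real number f', so gamma'.i gamma is the
    coefficient F = T_u.T_v of the metric. *)
Lemma axial_gen m q q1 : axial q q1 = dot (emb q1) (gen m (emb q)).
Proof.
destruct q as [[x y] z], q1 as [[x1 y1] z1].
unfold axial, emb, gen, dot, dotC; simpl; ring.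
Qed.

(** The law W' = h s' / 2 multiplied by 2 g^(3/2). Here gamma = (x, y) and f = z; E, F, G are the
    metric coefficients, K is det(gamma', gamma''), and a, b, c are the products of the unnormalized
    normal with T_uu, T_uv, T_vv at v = 0. *)
Lemma momentum_identity (m x y z x1 y1 z1 x2 y2 z2 : R) :
  x * x + y * y + z * z = 1 -> x * x1 + y * y1 + z * z1 = 0 ->
  let E := x1 * x1 + y1 * y1 + z1 * z1 in
  let F := x * y1 - y * x1 in
  let G := x * x + y * y + m * z * (m * z) in
  let F' := x * y2 - y * x2 in
  let E' := 2 * (x1 * x2 + y1 * y2 + z1 * z2) in
  let G' := 2 * (x * x1 + y * y1 + m * m * z * z1) in
  let K := x1 * y2 - y1 * x2 in
  let a := m * z * (z1 * F' - z * K - F * z2) in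
  let b := m * z * (z1 * (x * x1 + y * y1) - z * (x1 * x1 + y1 * y1))
         - m * z1 * ((x * x + y * y) * z1 - z * (x * x1 + y * y1)) in
  let c := - (m * z * z * F) + m * m * (m * z * z * F) in
  (2 * (2 * z * z1 * F + z * z * F') * (E * G - F * F)
     - z * z * F * (E' * G + E * G' - 2 * F * F')) * m
  = - 2 * (a * G - 2 * b * F + c * E) * (x * x1 + y * y1).
Proof.
intros H1 H2 E F G F' E' G' K a b c.
assert (HB : x * x1 + y * y1 = - (z * z1)) by (rewrite <- (Rplus_0_r (- (z * z1))), <- H2; ring).
assert (HS : x * x + y * y = 1 - z * z) by (rewrite <- H1; ring).
assert (Hb : b = - m * (z * z * E + z1 * z1)).
{ unfold b; rewrite HB, HS; unfold E; ring. }
assert (HG : G = 1 - (1 - m * m) * (z * z)) by (unfold G; rewrite HS; ring).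
assert (HG' : G' = - 2 * (1 - m * m) * (z * z1)) by (unfold G'; rewrite HB; ring).
assert (Hc : c = - (1 - m * m) * m * (z * z) * F) by (unfold c; ring).
(* Lagrange's identity for gamma and gamma' *)
assert (HE : E * (1 - z * z) = F * F + z1 * z1).
{ transitivity (F * F + (x * x1 + y * y1) * (x * x1 + y * y1) + (x * x + y * y) * (z1 * z1)).
  - unfold E, F; rewrite <- HS; ring.
  - rewrite HB, HS; ring. }
(* the dot product of gamma'' with
   |gamma'|^2 i gamma - (gamma'.i gamma) gamma' - (gamma.gamma') i gamma' = 0 *)
assert (HK : F' * E - F * (E' / 2) = z1 * (z1 * F' - z * K - F * z2)).
{ transitivity (F' * (x1 * x1 + y1 * y1) + F' * (z1 * z1) - F * (x1 * x2 + y1 * y2) - F * z1 * z2).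
  - unfold E, E'; field.
  - transitivity ((x * x1 + y * y1) * K + F' * (z1 * z1) - F * z1 * z2).
    + unfold F, F', K; ring.
    + rewrite HB; ring. }
rewrite HB, HG', Hb, Hc.
(* On the left, second derivatives survive only in F' E - F E' / 2. By [HK] this is z1 times the
   bracket in [a], so they cancel against the term a G on the right; what remains is a multiple of
   [HE]. *)
transitivity (2 * m * (z * z * G * (F' * E - F * (E' / 2)) + 2 * z * z1 * F * (E * G - F * F)
   + (1 - m * m) * (z * z * z * z1) * F * E)).
- field.
- rewrite HK.
  apply Rminus_diag_uniq.
  transitivity (4 * m * z * z1 * F * (E * (1 - z * z) - F * F - z1 * z1)).
  + rewrite HG; unfold a; ring.
  + rewrite HE; ring.
Qed.

(** [momentum_identity] divided by 2 r^3, with r = sqrt g. The left side has the shape in which the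
    product rule and the derivative of 1 / sqrt g deliver W'; the right side is h (gamma.gamma'). *)
Lemma momentum_rate (m r : R) (q q1 q2 : CxR) :
  0 < r -> r * r = gram2 (emb q1) (gen m (emb q)) ->
  dot (emb q) (emb q) = 1 -> dot (emb q) (emb q1) = 0 ->
  let p := emb q in let p1 := emb q1 in let p2 := emb q2 in
  let g' := 2 * dot p1 p2 * dot (gen m p) (gen m p)
            + dot p1 p1 * (2 * dot (gen m p) (gen m p1))
            - 2 * dot p1 (gen m p) * (dot p2 (gen m p) + dot p1 (gen m p1)) in
  (m * (2 * snd q * snd q1)) * dot p1 (gen m p) * / r
  + m * (snd q * snd q) * (dot p2 (gen m p) + dot p1 (gen m p1)) * / r
  + m * (snd q * snd q) * dot p1 (gen m p) * (- g' / (2 * (r * r) * r))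
  = - (dot (cross p p1 (gen m p)) p2 * dot (gen m p) (gen m p)
     - 2 * dot (cross p p1 (gen m p)) (gen m p1) * dot p1 (gen m p)
     + dot (cross p p1 (gen m p)) (gen m (gen m p)) * dot p1 p1) / (r * r * r)
    * dotC (fst q) (fst q1).
Proof.
intros Hr Hg Hq Hq1 p p1 p2 g'.
apply Rmult_eq_reg_l with (2 * (r * r) * r); [|assert (0 < r * r) by nra; nra].
match goal with |- ?k * (?a * / r + ?b * / r + ?c * (- ?d / _)) = _ * (- ?e / _ * ?t) =>
  transitivity (2 * (r * r) * (a + b) - c * d); [field; lra|];
  transitivity (- 2 * e * t); [|field; lra] end.
rewrite Hg; unfold g', p, p1, p2; clear g' p p1 p2 Hg Hr r.
revert Hq Hq1.
destruct q as [[x y] z], q1 as [[x1 y1] z1], q2 as [[x2 y2] z2].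
unfold gram2, cross, det2, emb, gen, dot, dotC; simpl.
intros Hq Hq1.
assert (H1 : x * x + y * y + z * z = 1) by lra.
assert (H2 : x * x1 + y * y1 + z * z1 = 0) by lra.
assert (H := momentum_identity m x y z x1 y1 z1 x2 y2 z2 H1 H2).
cbv zeta in H.
match type of H with ?a = ?b =>
  transitivity a; [ring | rewrite H; ring] end.
Qed.

(** The hypotheses say that s' = s'' = 0 at the point, together with the second derivative of the
    sphere equation. The surface then agrees to second order with the torus of that value of s.
    There, up to a common sign, W is sqrt(s (1 - s)) and the principal curvatures are sqrt((1 - s) /
    s) and - sqrt(s / (1 - s)); their sum times W is 1 - 2 s. *)
Lemma momentum_critical (m : R) (q q1 q2 : CxR) :
  0 < m -> 0 < gram2 (emb q1) (gen m (emb q)) ->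
  dot (emb q) (emb q) = 1 -> dot (emb q) (emb q1) = 0 ->
  dotC (fst q) (fst q1) = 0 -> dotC (fst q1) (fst q1) + dotC (fst q) (fst q2) = 0 ->
  dot (emb q1) (emb q1) + dot (emb q) (emb q2) = 0 ->
  momentum m q q1 <> 0 /\
  twizzler_mean_curvature m q q1 q2 * momentum m q q1 = 1 - 2 * dotC (fst q) (fst q).
Proof.
intros Hm Hg.
assert (Hs := sqrt_lt_R0 _ Hg).
assert (Hss := sqrt_sqrt _ (Rlt_le _ _ Hg)).
unfold twizzler_mean_curvature, twizzled_mean_curvature, momentum.
set (r := sqrt _) in *.
rewrite <- Hss; rewrite <- Hss in Hg.
rewrite (axial_gen m).
destruct q as [[x y] z], q1 as [[x1 y1] z1], q2 as [[x2 y2] z2].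
revert Hss; unfold gram2, cross, det2, emb, gen, dot, dotC; simpl.
intros Hss H1 H2 H3 H4 H5.
(* If z = 0, then subtracting [H4] from [H5] gives z1 = 0. The metric determinant reduces to
   |gamma|^2 |gamma'|^2 - F^2 = (gamma.gamma')^2 = 0, contrary to its positivity. *)
assert (Hz : z <> 0).
{ intros ->.
  assert (r * r = 0); [|nra]. rewrite Hss.
  clear -H1 H2 H3 H4 H5. assert (z1 * z1 = 0) by nsatz.
  assert (z1 = 0) by nra. nsatz. }
assert (z1 = 0) by (apply Rmult_eq_reg_l with z; [nsatz | auto]); subst z1.
assert (z2 = 0) by (apply Rmult_eq_reg_l with z; [nsatz | auto]); subst z2.
set (E := x1 * x1 + y1 * y1).
set (F := x1 * - y + y1 * x).
set (S := x * x + y * y).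
set (K := x1 * y2 - y1 * x2).
(* Lagrange's identity for gamma, gamma', and below it the Binet-Cauchy identity for det(gamma,
   gamma') det(gamma', gamma''), both with gamma.gamma' = 0 and the second with gamma.gamma'' = -
   E. *)
assert (HFF : F * F = S * E).
{ transitivity (S * E - (x * x1 + y * y1) * (x * x1 + y * y1)).
  - unfold F, S, E; ring.
  - rewrite H3; ring. }
assert (HFK : F * K = E * E).
{ transitivity ((x * x1 + y * y1) * (x1 * x2 + y1 * y2) - E * (x * x2 + y * y2)).
  - unfold F, K, E; ring.
  - replace (x * x2 + y * y2) with (- E) by (unfold E; lra).
    rewrite H3; ring. }
assert (HS : S + z * z = 1) by (unfold S; lra).
assert (Hg' : r * r = m * m * (z * z) * E).
{ rewrite Hss; transitivity (E * (S + m * m * (z * z)) - F * F); [|rewrite HFF; ring].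
  unfold E, F, S; ring. }
split.
- intros H0.
  assert (HF : F = 0).
  { apply (f_equal (fun t => t * r)) in H0.
    match type of H0 with ?l = _ =>
      replace l with (m * z * z * F) in H0 by (unfold F; field; lra) end.
    rewrite Rmult_0_l in H0.
    apply Rmult_integral in H0; destruct H0 as [H0|H0]; [exfalso|exact H0].
    assert (m * z <> 0) by (apply Rmult_integral_contrapositive; split; lra).
    apply Rmult_integral in H0; destruct H0; contradiction. }
  assert (HE : E * E = 0) by (rewrite <- HFK, HF; ring).
  apply Rmult_integral in HE.
  assert (E = 0) by tauto.
  nra.
- match goal with |- - ?N / _ * (?M / _) = ?R =>
    transitivity (- N * M / ((r * r) * (r * r))); [field; lra|];
    cut (- N * M = R * ((r * r) * (r * r))); [intros E0; rewrite E0; field; lra|] end.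
  rewrite Hg'.
  transitivity (m * m * (z * z * (z * z)) * (F * K * (S + m * m * (z * z)) - E * (1 + m * m) * (F * F))).
  + unfold E, F, S, K; ring.
  + rewrite HFK, HFF; replace (z * z) with (1 - S) by lra.
    fold S; ring.
Qed.

(** * Tori and the modulus of gamma *)

Lemma polar_form (r : R) (w : C) :
  dotC w w = r * r -> exists s, w = (RtoC r * expi s)%C.
Proof.
destruct w as [x y]; unfold dotC, expi; simpl; intros H.
destruct (Req_dec r 0) as [->|Hr].
- exists 0; unfold Cmult; simpl; apply f_equal2; nra.
- set (c := x / r).
  assert (Hc : c * c + (y / r) * (y / r) = 1).
  { unfold c; transitivity ((x * x + y * y) / (r * r)); [field; auto|].
    rewrite H; field; auto. }
  assert (Hcb : -1 <= c <= 1) by nra.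
  assert (Hsin : sin (acos c) = Rabs (y / r)).
  { rewrite sin_acos by exact Hcb.
    replace (1 - Rsqr c) with (Rsqr (y / r)) by (unfold Rsqr; lra).
    apply sqrt_Rsqr_abs. }
  assert (Hx : r * c = x) by (unfold c; field; auto).
  assert (Hy : r * (y / r) = y) by (field; auto).
  destruct (Rle_dec 0 (y / r)) as [Hp|Hn].
  + exists (acos c); unfold Cmult; simpl.
    rewrite cos_acos, Hsin, Rabs_pos_eq by auto.
    apply f_equal2; lra.
  + exists (- acos c); unfold Cmult; simpl.
    rewrite cos_neg, sin_neg, cos_acos, Hsin, Rabs_left by lra.
    apply f_equal2; lra.
Qed.

Lemma dotC_fst_rot m v p : dotC (fst (rot m v p)) (fst (rot m v p)) = dotC (fst p) (fst p).
Proof.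
transitivity ((cos v * cos v + sin v * sin v) * dotC (fst p) (fst p)).
- unfold rot, expi, Cmult, dotC; simpl; ring.
- rewrite cos2_sin2; ring.
Qed.

Lemma dotC_snd_rot m v p : dotC (snd (rot m v p)) (snd (rot m v p)) = dotC (snd p) (snd p).
Proof.
transitivity ((cos (m * v) * cos (m * v) + sin (m * v) * sin (m * v)) * dotC (snd p) (snd p)).
- unfold rot, expi, Cmult, dotC; simpl; ring.
- rewrite cos2_sin2; ring.
Qed.

(** [rot] preserves the modulus of each complex factor, so the condition concerns the curve [P]
    alone. The angle acos(sqrt s) has cosine sqrt s and sine sqrt(1 - s), the moduli of the two
    factors. *)
Lemma lies_on_torus_iff (I : R -> Prop) (m : R) (P : R -> R4) :
  (forall u, I u -> dot (P u) (P u) = 1) ->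
  (exists u, I u) ->
  lies_on_torus I (fun u v => rot m v (P u)) <->
  exists s, forall u, I u -> dotC (fst (P u)) (fst (P u)) = s.
Proof.
intros HS [u0 Hu0]; split.
- intros [xi Hxi]; exists (cos xi * cos xi); intros u Hu.
  destruct (Hxi u 0 Hu) as (s & t & E).
  rewrite <- (dotC_fst_rot m 0), E.
  transitivity (cos xi * cos xi * (cos s * cos s + sin s * sin s)).
  + unfold expi, Cmult, dotC; simpl; ring.
  + rewrite cos2_sin2; ring.
- intros [s Hs].
  assert (Hsnd : forall u, I u -> dotC (snd (P u)) (snd (P u)) = 1 - s).
  { intros u Hu; rewrite <- (HS u Hu), <- (Hs u Hu); unfold dot; ring. }
  assert (0 <= s) by (rewrite <- (Hs u0 Hu0); unfold dotC; nra).
  assert (0 <= 1 - s) by (rewrite <- (Hsnd u0 Hu0); unfold dotC; nra).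
  assert (Hq : sqrt s * sqrt s = s) by (apply sqrt_sqrt; lra).
  assert (Hb : -1 <= sqrt s <= 1).
  { assert (0 <= sqrt s) by apply sqrt_pos; nra. }
  exists (acos (sqrt s)); intros u v Hu.
  rewrite cos_acos, sin_acos by exact Hb.
  destruct (polar_form (sqrt s) (fst (rot m v (P u)))) as [a Ha].
  { rewrite dotC_fst_rot, Hs by auto; lra. }
  destruct (polar_form (sqrt (1 - Rsqr (sqrt s))) (snd (rot m v (P u)))) as [b Hb'].
  { rewrite dotC_snd_rot, Hsnd by auto; unfold Rsqr; rewrite Hq, sqrt_sqrt; auto. }
  exists a, b; rewrite <- Ha, <- Hb'; apply surjective_pairing.
Qed.

(** * Mean curvature and momentum along the profile curve *)

Section Profile.
Variables (I : R -> Prop) (m : R) (q q1 q2 : R -> CxR).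
Hypothesis HI : is_interval I.
Hypothesis Hm : 0 < m.
Hypothesis Hq : forall u, I u -> is_derive_in I q u (q1 u).
Hypothesis Hq1 : forall u, I u -> is_derive_in I q1 u (q2 u).
Hypothesis Hq2 : continuous_on I q2.
Hypothesis HS : forall u, I u -> dot (emb (q u)) (emb (q u)) = 1.
Hypothesis Himm : immersion_on I (fun u v => rot m v (emb (q u))).

Let P u := emb (q u).
Let P1 u := emb (q1 u).
Let P2 u := emb (q2 u).
Let h u := twizzler_mean_curvature m (q u) (q1 u) (q2 u).
Let w u := momentum m (q u) (q1 u).
Let s u := dotC (fst (q u)) (fst (q u)).
Let b u := dotC (fst (q u)) (fst (q1 u)).

Let HP u (Hu : I u) : is_derive_in I P u (P1 u) := is_derive_in_emb I q u (q1 u) (Hq u Hu).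
Let HP1 u (Hu : I u) : is_derive_in I P1 u (P2 u) := is_derive_in_emb I q1 u (q2 u) (Hq1 u Hu).

Lemma coords_in_continuous_of_deriv (J : R -> Prop) (X : R -> R4) x l :
  J x -> is_derive_in J X x l -> coords_in (fun f => continuous_in J f x) X.
Proof.
intros Hx HX; apply is_derive_in_R4 in HX; destruct HX as [[] []].
split; split; eapply has_deriv_continuous; eauto.
Qed.

(** Here the continuity of the second derivative enters: h is polynomial in [P], [P1], [P2], divided
    by g sqrt g, which stays positive. *)
Lemma mean_curvature_continuous u : I u -> continuous_in I h u.
Proof.
intros Hu.
set (K := fun f => continuous_in I f u).
assert (HK : function_algebra K) by apply function_algebra_continuous.
assert (K0 : coords_in K P) by exact (coords_in_continuous_of_deriv I P u _ Hu (HP u Hu)).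
assert (K1 : coords_in K P1) by exact (coords_in_continuous_of_deriv I P1 u _ Hu (HP1 u Hu)).
assert (K2 : coords_in K P2).
{ assert (cfst : forall (U V : UniformSpace) (p : U * V), continuous fst p)
    by (intros U V [a c]; apply continuous_fst).
  assert (csnd : forall (U V : UniformSpace) (p : U * V), continuous snd p)
    by (intros U V [a c]; apply continuous_snd).
  assert (Hf := filterlim_comp _ _ _ _ _ _ _ _ (Hq2 u Hu) (cfst _ _ (q2 u))).
  split; split.
  - exact (filterlim_comp _ _ _ _ _ _ _ _ Hf (cfst R_UniformSpace R_UniformSpace (fst (q2 u)))).
  - exact (filterlim_comp _ _ _ _ _ _ _ _ Hf (csnd R_UniformSpace R_UniformSpace (fst (q2 u)))).
  - exact (filterlim_comp _ _ _ _ _ _ _ _ (Hq2 u Hu) (csnd _ _ (q2 u))).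
  - apply (fa_const _ HK). }
assert (Kg := coords_in_gen K m P HK K0).
assert (Kn := coords_in_cross K _ _ _ HK K0 K1 Kg).
assert (KD := fa_gram2 K _ _ HK K1 Kg).
assert (Hg := gram2_pos I m P P1 HI HP Himm u Hu).
assert (Hs := sqrt_lt_R0 _ Hg).
assert (KD' : K (fun t => / (gram2 (P1 t) (gen m (P t)) * sqrt (gram2 (P1 t) (gen m (P t)))))).
{ apply (continuous_in_comp I u (fun t => gram2 (P1 t) (gen m (P t))) (fun y => / (y * sqrt y)) KD).
  apply (continuous_comp (fun y => y * sqrt y) Rinv).
  - apply (continuous_mult (K := R_AbsRing)); [apply continuous_id | apply continuous_sqrt].
  - apply continuous_Rinv; nra. }
assert (A1 := fa_dot K _ _ HK Kn K2).
assert (A2 := fa_dot K _ _ HK Kg Kg).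
assert (A3 := fa_dot K _ _ HK Kn (coords_in_gen K m _ HK K1)).
assert (A4 := fa_dot K _ _ HK K1 Kg).
assert (A5 := fa_dot K _ _ HK Kn (coords_in_gen K m _ HK Kg)).
assert (A6 := fa_dot K _ _ HK K1 K1).
change (K h); unfold h, twizzler_mean_curvature, twizzled_mean_curvature; cbv zeta; unfold Rdiv.
in_algebra HK.
Qed.

Lemma has_deriv_snd u : I u -> has_deriv I (fun t => snd (q t)) u (snd (q1 u)).
Proof. intros Hu; exact (is_derive_in_snd (V := C_R_NormedModule) (W := R_NormedModule) I q u _ (Hq u Hu)). Qed.

Lemma has_deriv_dotC (X Y : R -> C) u k l :
  I u -> is_derive_in (V := C_R_NormedModule) I X u k ->
  is_derive_in (V := C_R_NormedModule) I Y u l ->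
  has_deriv I (fun t => dotC (X t) (Y t)) u (dotC k (Y u) + dotC (X u) l).
Proof.
intros Hu HX HY; apply is_derive_in_C in HX, HY; destruct HX as [X1 X2], HY as [Y1 Y2].
eapply has_deriv_eq; [exact Hu | | reflexivity |].
- apply has_deriv_plus; (apply has_deriv_mult; [exact Hu | |]); [exact X1 | exact Y1 | exact X2 | exact Y2].
- unfold dotC; ring.
Qed.

Let Hfst u (Hu : I u) :
  is_derive_in (V := C_R_NormedModule) I (fun t => fst (q t)) u (fst (q1 u)) :=
  is_derive_in_fst (V := C_R_NormedModule) (W := R_NormedModule) I q u _ (Hq u Hu).
Let Hfst1 u (Hu : I u) :
  is_derive_in (V := C_R_NormedModule) I (fun t => fst (q1 t)) u (fst (q2 u)) :=
  is_derive_in_fst (V := C_R_NormedModule) (W := R_NormedModule) I q1 u _ (Hq1 u Hu).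

Lemma has_deriv_norm2 u : I u -> has_deriv I s u (2 * b u).
Proof.
intros Hu; eapply has_deriv_eq; [exact Hu |
  exact (has_deriv_dotC _ _ u _ _ Hu (Hfst u Hu) (Hfst u Hu)) | reflexivity |].
unfold b, dotC; ring.
Qed.

Lemma has_deriv_radial u : I u ->
  has_deriv I b u (dotC (fst (q1 u)) (fst (q1 u)) + dotC (fst (q u)) (fst (q2 u))).
Proof. intros Hu; exact (has_deriv_dotC _ _ u _ _ Hu (Hfst u Hu) (Hfst1 u Hu)). Qed.

Lemma has_deriv_momentum u : I u -> has_deriv I w u (h u * b u).
Proof.
intros Hu.
assert (Hg := gram2_pos I m P P1 HI HP Himm u Hu).
assert (Hs := sqrt_lt_R0 _ Hg).
assert (Hss := sqrt_sqrt _ (Rlt_le _ _ Hg)).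
assert (Hgen : is_derive_in I (fun t => gen m (P t)) u (gen m (P1 u))) by (apply is_derive_in_gen; auto).
assert (Dz := has_deriv_snd u Hu).
assert (DE := has_deriv_dot I P1 P1 u _ _ Hu (HP1 u Hu) (HP1 u Hu)).
assert (DF := has_deriv_dot I P1 _ u _ _ Hu (HP1 u Hu) Hgen).
assert (DG := has_deriv_dot I _ _ u _ _ Hu Hgen Hgen).
assert (DD := has_deriv_plus _ _ _ _ _ _ (has_deriv_mult _ _ _ _ _ _ Hu DE DG)
   (has_deriv_mult _ _ _ _ _ _ Hu (has_deriv_const I u (-1)) (has_deriv_mult _ _ _ _ _ _ Hu DF DF))).
cbv beta in DD.
assert (DD' : has_deriv I (fun t => gram2 (P1 t) (gen m (P t))) u
  (2 * dot (P1 u) (P2 u) * dot (gen m (P u)) (gen m (P u))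
            + dot (P1 u) (P1 u) * (2 * dot (gen m (P u)) (gen m (P1 u)))
            - 2 * dot (P1 u) (gen m (P u)) * (dot (P2 u) (gen m (P u)) + dot (P1 u) (gen m (P1 u))))).
{ eapply has_deriv_eq; [exact Hu | exact DD | |].
  - intros t; unfold gram2; cbv beta; ring.
  - rewrite (dot_comm (P2 u) (P1 u)), (dot_comm (gen m (P1 u)) (gen m (P u))); ring. }
assert (Dr := has_deriv_inv_sqrt I _ u _ Hu DD' Hg).
assert (Dm := has_deriv_mult _ _ _ _ _ _ Hu (has_deriv_const I u m) (has_deriv_mult _ _ _ _ _ _ Hu Dz Dz)).
assert (DW := has_deriv_mult _ _ _ _ _ _ Hu (has_deriv_mult _ _ _ _ _ _ Hu Dm DF) Dr).
cbv beta in DW.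
eapply has_deriv_eq; [exact Hu | exact DW | |].
- intros t; cbv beta; unfold w, momentum; rewrite (axial_gen m); unfold Rdiv, P, P1; ring.
- unfold h, twizzler_mean_curvature, twizzled_mean_curvature, b; cbv zeta.
  assert (HR := momentum_rate m _ (q u) (q1 u) (q2 u) Hs Hss (HS u Hu) (dot_P_P1 I P P1 HI HP HS u Hu)).
  cbv zeta in HR.
  rewrite Hss in HR.
  change (emb (q u)) with (P u) in *.
  change (emb (q1 u)) with (P1 u) in *; change (emb (q2 u)) with (P2 u) in *.
  rewrite <- HR; ring.
Qed.

(** If b = s' / 2 vanishes near [u] within [I], then its derivative at [u] is 0 as well, even at an
    end point. This gives the two conditions on gamma in [momentum_critical]; the last condition
    there is the derivative of P.P' = 0. *)
Lemma critical_relation u d :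
  I u -> 0 < d -> (forall t, I t -> Rabs (t - u) < d -> b t = 0) ->
  w u <> 0 /\ h u * w u = 1 - 2 * s u.
Proof.
intros Hu Hd Hb.
assert (Hbu : b u = 0) by (apply Hb; [exact Hu | rewrite Rminus_diag, Rabs_R0; exact Hd]).
apply momentum_critical; auto.
- exact (gram2_pos I m P P1 HI HP Himm u Hu).
- exact (dot_P_P1 I P P1 HI HP HS u Hu).
- apply (has_deriv_unique I u b); auto using has_deriv_radial.
  apply (is_derive_in_ext_loc (V := R_NormedModule) I u (fun _ => 0));
    [exact Hu | | apply has_deriv_const].
  exists (mkposreal d Hd); intros t Ht It; symmetry; apply Hb; auto.
- assert (H := dot_deriv_orth I P P1 u _ _ HI Hu (HP u Hu) (HP1 u Hu) (dot_P_P1 I P P1 HI HP HS)).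
  change (dot (P1 u) (P1 u) + dot (P u) (P2 u) = 0); lra.
Qed.

Lemma mean_curvature_locally_constant u d :
  I u -> 0 < d -> (forall t, I t -> Rabs (t - u) < d -> b t = 0) ->
  forall y, I y -> Rabs (y - u) < d -> h y = h u.
Proof.
intros Hu Hd Hb y Hy Hyu.
assert (Hbt : forall t, I t -> Rmin u y <= t <= Rmax u y -> b t = 0).
{ intros t It Ht; apply Hb; [exact It|].
  apply Rle_lt_trans with (Rabs (y - u)); [|exact Hyu].
  revert Ht; unfold Rmin, Rmax; destruct Rle_dec; intros;
    unfold Rabs; repeat destruct Rcase_abs; lra. }
assert (Es : s u = s y).
{ apply (has_deriv_zero_eq I); auto; intros t It Ht.
  replace 0 with (2 * b t) by (rewrite Hbt; auto; ring); apply has_deriv_norm2; auto. }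
assert (Ew : w u = w y).
{ apply (has_deriv_zero_eq I); auto; intros t It Ht.
  replace 0 with (h t * b t) by (rewrite Hbt; auto; ring); apply has_deriv_momentum; auto. }
destruct (critical_relation u d Hu Hd Hb) as [Hw Hr].
destruct (critical_relation y (d - Rabs (y - u)) Hy) as [Hw' Hr'].
- lra.
- intros t It Ht; apply Hb; auto.
  replace (t - u) with ((t - y) + (y - u)) by ring.
  eapply Rle_lt_trans; [apply Rabs_triang | lra].
(* As s and w take the same values at both points, so does the product h w = 1 - 2 s; the factor w
   can be cancelled because it is nonzero. *)
- apply Rmult_eq_reg_r with (w u); auto.
  rewrite Hr, Ew, Hr', Es; reflexivity.
Qed.

Lemma first_integral_deriv H u :
  I u -> has_deriv I (fun t => 2 * w t - H * s t) u (2 * (h u - H) * b u).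
Proof.
intros Hu; eapply has_deriv_eq; [exact Hu | | |].
- exact (has_deriv_lincomb I 2 (- H) _ _ _ _ _ Hu (has_deriv_momentum u Hu) (has_deriv_norm2 u Hu)).
- intros t; simpl; ring.
- ring.
Qed.

Lemma conserved_of_constant_mean_curvature H :
  (forall u, I u -> h u = H) -> exists c, forall u, I u -> c = 2 * w u - H * s u.
Proof.
intros Hh; destruct HI as [_ (u0 & _ & Hu0 & _)].
exists (2 * w u0 - H * s u0); intros u Hu.
apply (has_deriv_zero_eq I (fun t => 2 * w t - H * s t)); auto.
intros t It _.
replace 0 with (2 * (h t - H) * b t) by (rewrite (Hh t It); ring).
apply first_integral_deriv, It.
Qed.

Lemma norm2_constant :
  (forall u, I u -> b u = 0) -> exists s0, forall u, I u -> s u = s0.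
Proof.
intros Hb; destruct HI as [_ (u0 & _ & Hu0 & _)].
exists (s u0); intros u Hu; symmetry.
apply (has_deriv_zero_eq I s); auto.
intros t It _.
replace 0 with (2 * b t) by (rewrite (Hb t It); ring).
apply has_deriv_norm2, It.
Qed.

Lemma constant_mean_curvature_of_norm2_constant s0 :
  (forall u, I u -> s u = s0) -> exists k, forall u, I u -> h u = k.
Proof.
intros Hs0.
assert (Hb : forall u, I u -> b u = 0).
{ intros u Hu.
  assert (E : 2 * b u = 0); [|lra].
  apply (has_deriv_unique I u s); auto using has_deriv_norm2.
  apply (is_derive_in_ext (V := R_NormedModule) I u (fun _ => s0));
    [exact Hu | | apply has_deriv_const].
  intros y Hy; symmetry; auto. }
destruct HI as [_ (u0 & _ & Hu0 & _)].
exists (h u0); intros u Hu.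
(* Since b vanishes on all of [I], the radius is free; this one makes the ball about [u0] contain
   [u]. *)
apply (mean_curvature_locally_constant u0 (Rabs (u - u0) + 1)); auto.
- assert (0 <= Rabs (u - u0)) by apply Rabs_pos; lra.
- lra.
Qed.

(* If [h] took a value [k <> H], then [b] would vanish near each point where
   [h = k], so the indicator function of [h = k] would be locally constant on
   [I], hence [b = 0] on [I]. *)
Lemma mean_curvature_of_conserved H c :
  (forall u, I u -> c = 2 * w u - H * s u) ->
  ~ (exists s0, forall u, I u -> s u = s0) ->
  forall u, I u -> h u = H.
Proof.
intros Hc Hns u0 Hu0.
assert (Hhb : forall t, I t -> h t <> H -> b t = 0).
{ intros t It Ht.
  assert (E : 2 * (h t - H) * b t = 0).
  { apply (has_deriv_unique I t (fun t => 2 * w t - H * s t)); auto using first_integral_deriv.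
    apply (is_derive_in_ext (V := R_NormedModule) I t (fun _ => c));
      [exact It | exact Hc | apply has_deriv_const]. }
  apply Rmult_integral in E; destruct E; [lra | auto]. }
assert (Hsep : forall t k, I t -> h t <> k ->
          exists d, 0 < d /\ forall y, I y -> Rabs (y - t) < d -> h y <> k).
{ intros t k It Ht.
  assert (He : 0 < Rabs (h t - k)) by (apply Rabs_pos_lt; lra).
  destruct (mean_curvature_continuous t It (fun z => Rabs (z - h t) < Rabs (h t - k))) as [d Hd].
  - exists (mkposreal _ He); intros z Hz; exact Hz.
  - exists d; split; [apply cond_pos|]; intros y Iy Hy E.
    specialize (Hd y Hy Iy); simpl in Hd; rewrite E in Hd.
    rewrite (Rabs_minus_sym k) in Hd; lra. }
destruct (Req_dec (h u0) H) as [E|Hne]; [exact E | exfalso].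
set (k := h u0) in *.
set (ind := fun t => if Req_EM_T (h t) k then 1 else 0).
(* Near a point where h = k, continuity keeps h away from [H], so b = 0 there and h keeps the value
   k. Near a point where h differs from k, continuity keeps it different. *)
assert (Hind : forall t, I t -> has_deriv I ind t 0).
{ intros t It.
  apply (is_derive_in_ext_loc (V := R_NormedModule) I t (fun _ => ind t));
    [exact It | | apply has_deriv_const].
  unfold ind at 1; destruct (Req_EM_T (h t) k) as [Et|Et].
  - destruct (Hsep t H It) as [d [Hd Hdd]]; [lra|].
    exists (mkposreal d Hd); intros y Hy Iy.
    assert (Ey : h y = h t).
    { apply (mean_curvature_locally_constant t d); auto. }
    unfold ind; destruct (Req_EM_T (h y) k); [reflexivity | lra].
  - destruct (Hsep t k It Et) as [d [Hd Hdd]].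
    exists (mkposreal d Hd); intros y Hy Iy.
    unfold ind; destruct (Req_EM_T (h y) k); [|reflexivity].
    exfalso; apply (Hdd y Iy Hy); auto. }
apply Hns, norm2_constant.
intros u Hu; apply Hhb; [exact Hu|].
assert (E : ind u0 = ind u).
{ apply (has_deriv_zero_eq I ind); auto. }
unfold ind in E.
destruct (Req_EM_T (h u0) k); [|now destruct n].
destruct (Req_EM_T (h u) k); lra.
Qed.

Lemma has_mean_curvature_iff H :
  has_mean_curvature I (fun u v => rot m v (emb (q u))) H <-> forall u, I u -> h u = H.
Proof.
split.
- intros Hh u Hu; symmetry.
  apply (mean_curvature_iff I m P P1 P2 HI HP HP1 HS Himm u 0 H Hu), Hh, Hu.
- intros Hh u v Hu.
  apply (mean_curvature_iff I m P P1 P2 HI HP HP1 HS Himm u v H Hu); symmetry; apply Hh, Hu.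
Qed.

Lemma first_integral_iff H c :
  first_integral I m (fun u => fst (q u)) (fun u => snd (q u)) H c <->
  forall u, I u -> c / PI = 2 * w u - H * s u.
Proof.
assert (HPI := PI_RGT_0).
assert (key : forall u v, I u ->
  2 * PI / sqrt (metric_det I (twizzler m (fun u => fst (q u)) (fun u => snd (q u))) u v)
     * m * snd (q u) ^ 2
     * dotC (Derive_in (V := C_R_NormedModule) I (fun u => fst (q u)) u) (Ci * fst (q u))%C
   - H * PI * Cmod (fst (q u)) ^ 2 = PI * (2 * w u - H * s u)).
{ intros u v Hu.
  change (twizzler m (fun u => fst (q u)) (fun u => snd (q u))) with (fun u v => rot m v (P u)).
  rewrite (metric_det_twizzled I m P P1 HI HP u v Hu).
  rewrite (Derive_in_unique_C I _ u _ HI Hu (Hfst u Hu)).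
  assert (Hmod : Cmod (fst (q u)) ^ 2 = s u).
  { unfold Cmod; rewrite pow2_sqrt; [unfold s, dotC; ring | nra]. }
  rewrite Hmod; unfold w, momentum, axial, Rdiv, P, P1; ring. }
split.
- intros Hf u Hu; specialize (Hf u 0 Hu); rewrite key in Hf by auto.
  rewrite Hf; field; lra.
- intros Hf u v Hu; rewrite key, <- Hf by auto; field; lra.
Qed.

End Profile.

Theorem theorem3p6 (I : R -> Prop) (m : R) (gamma : R -> C) (f : R -> R)
  (hI : is_interval I) (hm : 0 < m)
  (hC2 : C2_on (V := CxR) I (fun u => (gamma u, f u)))
  (hsphere : forall u, I u -> Cmod (gamma u) ^ 2 + f u ^ 2 = 1)
  (himm : immersion_on I (twizzler m gamma f)) :
  (constant_mean_curvature I (twizzler m gamma f) <->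
     exists H c : R, first_integral I m gamma f H c) /\
  (forall H c : R, first_integral I m gamma f H c ->
     ~ lies_on_torus I (twizzler m gamma f) ->
     has_mean_curvature I (twizzler m gamma f) H).
Proof.
set (q := fun u => (gamma u, f u) : CxR) in *.
destruct hC2 as (Hd1 & Hd2 & Hq2).
set (q1 := Derive_in I q) in *; set (q2 := Derive_in I q1) in *.
assert (Hq : forall u, I u -> is_derive_in I q u (q1 u)).
{ intros u Hu; apply Derive_in_correct; auto. }
assert (Hq1 : forall u, I u -> is_derive_in I q1 u (q2 u)).
{ intros u Hu; apply Derive_in_correct; auto. }
assert (HS : forall u, I u -> dot (emb (q u)) (emb (q u)) = 1).
{ intros u Hu; rewrite <- (hsphere u Hu); unfold Cmod; rewrite pow2_sqrt by nra.
  unfold dot, dotC; simpl; ring. }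
change (twizzler m gamma f) with (fun u v => rot m v (emb (q u))) in *.
assert (Hcmc := has_mean_curvature_iff I m q q1 q2 hI Hq Hq1 HS himm).
assert (Hfi := first_integral_iff I m q q1 hI Hq).
change (fun u => fst (q u)) with gamma in Hfi; change (fun u => snd (q u)) with f in Hfi.
assert (Htor := lies_on_torus_iff I m (fun u => emb (q u)) HS).
assert (part2 : forall H c, first_integral I m gamma f H c ->
     ~ lies_on_torus I (fun u v => rot m v (emb (q u))) ->
     has_mean_curvature I (fun u v => rot m v (emb (q u))) H).
{ intros H c Hf Ht; apply Hcmc.
  apply (mean_curvature_of_conserved I m q q1 q2 hI hm Hq Hq1 Hq2 HS himm H (c / PI)).
  - apply Hfi, Hf.
  - intros Hs; apply Ht, Htor, Hs; destruct hI as [_ (u & _ & Hu & _)]; exists u; exact Hu. }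
split; [split|exact part2].
- intros [H HH]; exists H.
  destruct (conserved_of_constant_mean_curvature I m q q1 q2 hI Hq Hq1 HS himm H) as [c Hc].
  { apply Hcmc, HH. }
  exists (c * PI); apply Hfi; intros u Hu; rewrite <- (Hc u Hu); field.
  assert (H0 := PI_RGT_0); lra.
- intros (H & c & Hf).
  destruct (classic (lies_on_torus I (fun u v => rot m v (emb (q u))))) as [Ht|Ht].
  (* On a torus s and W are constant, so the first integral holds for every [H] with a suitable
     constant. The given [H] says nothing about the mean curvature, and its constant value k is
     obtained independently. *)
  + apply Htor in Ht; [|destruct hI as [_ (u & _ & Hu & _)]; exists u; exact Hu].
    destruct Ht as [s0 Hs0].
    destruct (constant_mean_curvature_of_norm2_constant
      I m q q1 q2 hI hm Hq Hq1 HS himm s0 Hs0) as [k Hk].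
    exists k; apply Hcmc, Hk.
  + exists H; apply (part2 H c); auto.
Qed.
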